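(* Let $m\ge1$ and let $L:\mathbb{R}^m\times\mathbb{R}^m\to\mathbb{R}$ be of class $C^2$ with $|L(x,p)|\le C(|x|^2+|x|^r+|p|^2)$ for all $x,p\in\mathbb{R}^m$, for some constants $C$ and $r\ge2$. Let $X$ be a smooth vector field on $\mathbb{R}$ whose flow $\phi_t$ exists for $t\in(-\delta,\delta)$, for some $\delta>0$. Let $u\in C_c^\infty(\mathbb{R},\mathbb{R}^m)$ and assume that for $t$ in a neighbourhood of $0$, for a.e. $x\in\mathbb{R}$, $$L\left(u\circ\phi_t(x),(-\Delta)^{\frac14}(u\circ\phi_t)(x)\right)=L\left(u(\phi_t(x)),\big((-\Delta)^{\frac14}u\big)(\phi_t(x))\right)\phi_t'(x).$$ Then, in the sense of distributions, $$C_{1,\frac14}\operatorname{div}_{\frac14}\left[\frac{D_pL\left(u(x),(-\Delta)^{\frac14}u(x)\right)\cdot u'(y)}{|x-y|^{\frac14}}\right]X+\frac{d}{dx}\left[L\left(u,(-\Delta)^{\frac14}u\right)\right]X$$ $$=C_{1,\frac14}\operatorname{div}_{\frac14}\left[\frac{D_pL\left(u(x),(-\Delta)^{\frac14}u(x)\right)\cdot u'(y)X(y)}{|x-y|^{\frac14}}\right]+\frac{d}{dx}\left[L\left(u,(-\Delta)^{\frac14}u\right)X\right].$$ In particular, if in addition $u$ satisfies $$C_{1,\frac14}\operatorname{div}_{\frac14}\left[\frac{D_pL\left(u(x),(-\Delta)^{\frac14}u(x)\right)\cdot u'(y)}{|x-y|^{\frac14}}\right]X+\frac{d}{dx}\left[L\left(u,(-\Delta)^{\frac14}u\right)\right]X=0$$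 in the sense of distributions, then $$C_{1,\frac14}\operatorname{div}_{\frac14}\left[\frac{D_pL\left(u(x),(-\Delta)^{\frac14}u(x)\right)\cdot u'(y)X(y)}{|x-y|^{\frac14}}\right]+\frac{d}{dx}\left[L\left(u,(-\Delta)^{\frac14}u\right)X\right]=0$$ in the sense of distributions.
   Context: $C_{1,\frac14}$ is the constant such that $(-\Delta)^{\frac14}v(x)=C_{1,\frac14}\int_{\mathbb{R}}\frac{v(x)-v(y)}{|x-y|^{3/2}}dy$ for $v\in\mathscr{S}(\mathbb{R})$, where $(-\Delta)^{\frac14}$ is the Fourier multiplier $|\xi|^{\frac12}$. For $F:\mathbb{R}\times\mathbb{R}\to\mathbb{R}$, $\operatorname{div}_{\frac14}F$ is the distribution $\varphi\mapsto\int_{\mathbb{R}}\int_{\mathbb{R}}F(x,y)\frac{\varphi(x)-\varphi(y)}{|x-y|^{1/4}}\frac{dxdy}{|x-y|}$, $\varphi\in C_c^\infty(\mathbb{R})$, whenever the integral converges absolutely for all such $\varphi$. Vector fields on $\mathbb{R}$ are identified with functions; a distribution $T$ times $X$ acts by $TX[\varphi]=T[X\varphi]$. *)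

(* Defs.v *)
From mathcomp Require Export all_boot all_order all_algebra.
From mathcomp Require Export all_classical all_reals all_analysis.
Export Order.TTheory GRing.Theory Num.Theory.
Export numFieldNormedType.Exports.

Set Implicit Arguments.
Unset Strict Implicit.
Unset Printing Implicit Defensive.

Local Open Scope ring_scope.
Local Open Scope classical_set_scope.

(* Class C^k. All domains used here are finite dimensional, so that continuity
   of the differential is continuity of 'D_v f for each fixed direction v. *)
Fixpoint Ck (R : realType) (U V : normedModType R) (k : nat) (f : U -> V)
    : Prop :=
  if k is k'.+1 then
    (forall z, differentiable f z) /\ (forall v, Ck k' ('D_v f))
  else continuous f.

Definition smooth (R : realType) (V : normedModType R) (f : R -> V) : Prop :=
  forall n x, derivable (f^`(n)) x 1.

Definition Cc_infty (R : realType) (V : normedModType R) (f : R -> V) : Prop :=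
  smooth f /\ compact (closure [set x | f x != 0]).

Definition schwartz (R : realType) (v : R -> R) : Prop :=
  smooth v /\
  forall k n : nat, exists M : R, forall x, `|x| ^+ k * `|v^`(n) x| <= M.

Section Vectors.
Context (R : realType) (m : nat).
Implicit Types a b : 'rV[R]_m.

Definition dotprod a b : R := \sum_(i < m) a 0 i * b 0 i.

(* The library norm on 'rV[R]_m is the sup norm. *)
Definition enorm a : R := Num.sqrt (dotprod a a).

(* D_p L (x, p), as the vector of partial derivatives. *)
Definition grad_p (L : 'rV[R]_m -> 'rV[R]_m -> R) (x p : 'rV[R]_m) : 'rV[R]_m :=
  \row_(i < m) 'D_(delta_mx 0 i) (L x) p.

End Vectors.

Section QuarterLaplacian.
Context (R : realType).
Implicit Types v : R -> R.

(* For real v, the Fourier transform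
     \hat v(xi) = \int v(y) e^{-i y xi} dy = fourier_cos v xi - i fourier_sin v xi. *)
Definition fourier_cos v (xi : R) : R :=
  \int[lebesgue_measure]_y (v y * cos (y * xi)).

Definition fourier_sin v (xi : R) : R :=
  \int[lebesgue_measure]_y (v y * sin (y * xi)).

(* (-Delta)^{1/4} v(x) = 1/(2 pi) \int |xi|^{1/2} \hat v(xi) e^{i x xi} dxi.
   Only the real part of the integrand is kept: its imaginary part is odd
   in xi. *)
Definition qlap v (x : R) : R :=
  (2 * pi)^-1 * \int[lebesgue_measure]_xi
    (`|xi| `^ (1 / 2) *
     (fourier_cos v xi * cos (x * xi) + fourier_sin v xi * sin (x * xi))).

Definition qlapv (m : nat) (u : R -> 'rV[R]_m) (x : R) : 'rV[R]_m :=
  \row_(i < m) qlap (fun y => u y 0 i) x.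

(* The defining property of the constant C_{1,1/4}. The junk value of the
   integrand at y = x is irrelevant. *)
Definition is_C_1_quarter (C : R) : Prop :=
  forall v, schwartz v -> forall x,
    qlap v x =
    C * \int[lebesgue_measure]_y ((v x - v y) / `|x - y| `^ (3 / 2)).

End QuarterLaplacian.

Section Distributions.
Context (R : realType).
Implicit Types (f X phi : R -> R) (F : R -> R -> R).

(* Distributions are only ever evaluated at test functions. *)
Definition distribution := (R -> R) -> R.
Implicit Types T : distribution.

Definition distr_eq T1 T2 : Prop :=
  forall phi, Cc_infty phi -> T1 phi = T2 phi.

Definition distr_of f : distribution :=
  fun phi => \int[lebesgue_measure]_x (f x * phi x).

Definition distr_ddx T : distribution := fun phi => - T (phi^`()).

Definition distr_mul T X : distribution := fun phi => T (X \* phi).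

Definition div_quarter_integrand F phi (z : R * R) : R :=
  F z.1 z.2 * ((phi z.1 - phi z.2) / `|z.1 - z.2| `^ (1 / 4)) / `|z.1 - z.2|.

Definition div_quarter_defined F : Prop :=
  forall phi, Cc_infty phi ->
    (lebesgue_measure \x lebesgue_measure)%E.-integrable setT
      (EFin \o div_quarter_integrand F phi).

(* Meaningful only under div_quarter_defined F. *)
Definition div_quarter F : distribution :=
  fun phi => \int[(lebesgue_measure \x lebesgue_measure)%E]_z
    div_quarter_integrand F phi z.

(* phi is the flow of X on the time interval (-delta, delta). *)
Definition is_flow X (delta : R) (phi : R -> R -> R) : Prop :=
  (forall x, phi 0 x = x) /\
  (forall t x : R, `|t| < delta -> is_derive t 1 (phi^~ x) (X (phi t x))).

End Distributions.

(* Main.v *)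
From HB Require Import structures.
Require Import Defs.
From mathcomp Require Import measurable_realfun ring lra.

(** Write w for the quarter Laplacian of u, p for the gradient D_p L(u, w) and
    Lu for L(u, w). Test both sides against psi and subtract. Since

      [X(x) psi(x) - X(y) psi(y)] - X(y) [psi(x) - psi(y)]
        = (X(x) - X(y)) psi(x),

    Fubini's theorem reduces the identity of distributions to a pointwise one:
    for almost every x,

      C p(x) . int u'(y) (X(x) - X(y)) / |x - y|^{3/2} dy = Lu(x) X'(x).

    By the singular integral formula for the operator, applied to u' and to
    X u', the left-hand side is p(x) . c(x), where c = [qlap, X] u' is the
    commutator qlap(X u') - X qlap(u').

    That pointwise identity is the derivative at t = 0 of the invariance of L
    (noether_at_point). On the left, d/dt L(u o phi_t, qlap(u o phi_t)) is
    dL(X u', qlap(X u')). On the right, d/dt (Lu(phi_t) phi_t') is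
    dL(X u', X w') + Lu X', and w' = qlap(u'). Subtracting leaves
    dL(0, c) = Lu X', and dL(0, c) = p . c. The invariance holds almost
    everywhere for each t, so it is differentiated along a sequence t_n
    decreasing to 0, which meets countably many null sets (noether_ae).

    Three ingredients need work.

    - The singular integral formula is available for Schwartz functions, so
      u o phi_t must be smooth with compact support, and the derivative of
      phi_t' in t is needed. All that is given is the ordinary differential
      equation in t. Two trajectories never meet (Gronwall), so phi_t is
      increasing; hence trajectories issued from a bounded interval stay
      between the two extreme ones, in a bounded set on which X is Lipschitz,
      and phi_t is locally Lipschitz. The logarithm of a difference quotient
      of phi_t has derivative X'(phi_s) up to O(h), which gives
      phi_t' = exp (int_0^t X'(phi_s) ds) (flow_derive_space). This formula
      bootstraps: it makes phi_t as smooth as one likes (flow_tameC).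

    - The quarter Laplacian must be differentiated along the flow and along
      translations. If v is smooth with compact support, then
      (v(x) - v(y)) / |x - y|^{3/2} is dominated by a multiple of
      min(1, |x - y|) / |x - y|^{3/2}, which is integrable. The same bound,
      uniform in t, holds for the quotients (v o phi_t - v) / t, and dominated
      convergence applies (qlap_flow_along, qlap_derive).

    - The double integrals must converge absolutely. The function p is bounded
      on the whole line, because (u, w) takes its values in a compact set, and
      u' has compact support; Tonelli's theorem and the integrable majorant
      above conclude (integrable_div_quarter). *)

Set Implicit Arguments.
Unset Strict Implicit.
Unset Printing Implicit Defensive.

Local Open Scope ring_scope.
Local Open Scope classical_set_scope.

(** * Reflections of the Lebesgue measure and the integrable majorant *)

Section Reflection.
Context {R : realType}.
Local Notation mu := (@lebesgue_measure R).
Implicit Types (x : R).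

Lemma measurable_reflect x : measurable_fun [set: measurableTypeR R]
  ((fun y => x - y) : _ -> measurableTypeR R).
Proof. exact: measurable_funB. Qed.

(** The maps y |-> x - y carry out a translation and a reflection at once, and
    turn the kernel centred at x into the one centred
    at 0. *)
Lemma lebesgue_measure_reflect x (A : set (measurableTypeR R)) : measurable A ->
  pushforward mu ((fun y => x - y) : _ -> measurableTypeR R) A = mu A.
Proof.
move=> mA.
have mr := measurable_reflect x.
apply/esym/lebesgue_measure_unique => //= _ [[a b]] _ <-.
rewrite /pushforward /=.
rewrite (_ : _ @^-1` _ = `[x - b, x - a[%classic); last first.
  by apply/seteqP; split => y /=; rewrite !in_itv/=; lra.
rewrite !lebesgue_measure_itv/= !lte_fin ltrD2l ltrN2.
by case: ifP => // _; rewrite -!EFinD; congr EFin; lra.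
Qed.

Lemma ge0_integral_reflect (f : R -> \bar R) x : measurable_fun setT f ->
  (forall y, 0 <= f y)%E ->
  (\int[mu]_y f (x - y)%R = \int[mu]_y f y)%E.
Proof.
move=> mf f0.
have mr := measurable_reflect x.
rewrite -[RHS](@eq_measure_integral _ _ _ _ _
  (pushforward mu ((fun y => x - y) : _ -> measurableTypeR R))); last first.
  by move=> A mA _; exact: lebesgue_measure_reflect.
by rewrite (ge0_integral_pushforward mr)//.
Qed.

Lemma Rintegral_reflect (f : R -> R) x : measurable_fun setT f ->
  \int[mu]_y f (x - y) = \int[mu]_y f y.
Proof.
move=> mf; rewrite /Rintegral; congr fine.
rewrite integralE [in RHS]integralE; congr (_ - _)%E.
- transitivity (\int[mu]_y ((fun y => (f y)%:E)^\+ (x - y)%R))%E.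
    by apply: eq_integral => y _; rewrite ?funeposE ?funenegE.
  rewrite (@ge0_integral_reflect ((fun y => (f y)%:E)^\+%E) x)//=.
  by apply: measurable_funepos; exact/measurable_EFinP.
- transitivity (\int[mu]_y ((fun y => (f y)%:E)^\- (x - y)%R))%E.
    by apply: eq_integral => y _; rewrite ?funeposE ?funenegE.
  rewrite (@ge0_integral_reflect ((fun y => (f y)%:E)^\-%E) x)//=.
  by apply: measurable_funeneg; exact/measurable_EFinP.
Qed.

Lemma integrable_reflect (f : R -> R) x : mu.-integrable setT (EFin \o f) ->
  mu.-integrable setT (fun y => (f (x - y))%:E).
Proof.
move=> /integrableP[mf foo]; apply/integrableP; split.
  exact: (measurableT_comp mf (measurable_reflect x)).
by rewrite (@ge0_integral_reflect (fun y => `|(f y)%:E|%E) x)//; exact: measurableT_comp.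
Qed.

End Reflection.

Section Majorant.
Context {R : realType}.
Local Notation mu := (@lebesgue_measure R).

(** The numerator bounds the increments of a bounded Lipschitz function up to a
    constant; it removes the singularity of |h|^{-3/2} at 0 down to |h|^{-1/2}
    without spoiling its decay at infinity. *)
Definition majorant (h : R) : R := Num.min 1 `|h| / `|h| `^ (3 / 2).

Lemma majorant_ge0 h : 0 <= majorant h.
Proof. by rewrite divr_ge0// ?powR_ge0// le_min ler01 normr_ge0. Qed.

Lemma majorantN h : majorant (- h) = majorant h.
Proof. by rewrite /majorant normrN. Qed.

Lemma measurable_quotient_powR (f : R -> R) (c x : R) : measurable_fun setT f ->
  measurable_fun setT (fun y => f y / `|x - y| `^ c).
Proof.
move=> mf; under eq_fun do rewrite -powRN.
apply: measurable_funM => //.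
apply: (measurableT_comp (measurable_powR _)).
by apply: measurableT_comp => //; exact: measurable_funB.
Qed.

Lemma measurable_majorant : measurable_fun setT majorant.
Proof.
rewrite (_ : majorant = fun y => (Num.min 1 `|y|) / `|0 - y| `^ (3 / 2)); last first.
  by apply/funext => y; rewrite /majorant sub0r normrN.
apply: measurable_quotient_powR; exact: measurable_minr.
Qed.

Lemma majorant_le_near h : 0 < h -> majorant h <= h `^ (- (1/2)).
Proof.
move=> h0; rewrite /majorant gtr0_norm// (_ : - (1/2) = 1 - 3/2); last by lra.
rewrite powRB ?(gt_eqF h0) ?implybT// powRr1 ?(ltW h0)//.
by rewrite ler_pM2r ?invr_gt0 ?powR_gt0// ge_min lexx orbT.
Qed.

Lemma majorant_le_far h : 0 < h -> majorant h <= h `^ (- (3/2)).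
Proof.
move=> h0; rewrite /majorant gtr0_norm// powRN -[leRHS]mul1r.
by rewrite ler_pM2r ?invr_gt0 ?powR_gt0// ge_min lexx.
Qed.

(** The antiderivative 2 sqrt(x) is bounded, so the integrals over [1/n, 1] are
    at most 2, and they exhaust the improper integral. *)
Lemma integral_near_finite : (\int[mu]_(x in `]0%R, 1%R]) (x `^ (- (1/2)))%:E <= 2%:E)%E.
Proof.
pose F n : set R := `[n.+1%:R^-1, 1].
have FE : `]0, 1]%classic = \bigcup_n F n.
  apply/seteqP; split=> [x/=|x [n _] /=]; rewrite !in_itv/= => /andP[x0 x1].
    have [n nx] : exists n, x^-1 < n.+1%:R :> R.
      exists (Num.truncn x^-1); exact: truncnS_gt.
    exists n => //; rewrite /F /= in_itv/= x1 andbT.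
    by rewrite -[leRHS]invrK lef_pV2 ?posrE ?invr_gt0// ltW.
  move: x0 x1; rewrite !bnd_simp => x0 ->; rewrite andbT.
  by apply: lt_le_trans x0; rewrite invr_gt0.
have mf D : measurable D -> measurable_fun D (fun x : R => (x `^ (- (1/2)))%:E).
  move=> mD; apply/measurable_EFinP; apply: measurable_funTS; exact: measurable_powR.
have cv : (\int[mu]_(x in F i) (x `^ (- (1/2)))%:E)%E @[i --> \oo] -->
    (\int[mu]_(x in `]0%R, 1%R]) (x `^ (- (1/2)))%:E)%E.
  rewrite FE; apply: ge0_nondecreasing_set_cvg_integral => //.
  - move=> m n mn; apply/subsetPset => x; rewrite /F/= !in_itv/= => /andP[a ->].
    by rewrite andbT (le_trans _ a)// lef_pV2 ?posrE// ler_nat.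
  - by move=> n; exact: measurable_itv.
  - by move=> n; apply: mf; exact: measurable_itv.
  - by move=> n x _; rewrite lee_fin powR_ge0.
rewrite -(cvg_lim _ cv)//; apply: lime_le; first by apply/cvg_ex; eexists; exact: cv.
apply: nearW => -[|n].
  by rewrite /F invr1 set_itv1 integral_set1 lee_fin.
have n1 : n.+2%:R^-1 < 1 :> R by rewrite invf_lt1// ltr1n.
have n0 : 0 < n.+2%:R^-1 :> R by rewrite invr_gt0.
have dF (x : R) : 0 < x -> is_derive x 1 (fun x => 2 * x `^ (1/2)) (x `^ (-(1/2))).
  move=> x0; have := is_derive1_powR (1/2) x0.
  rewrite (_ : 1/2 - 1 = -(1/2)); last by lra.
  move=> H; apply: trigger_derive => //.
  by rewrite /GRing.scale/= mulrA; field.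
rewrite (@continuous_FTC2 _ _ (fun x => 2 * x `^ (1/2)))//.
+ rewrite powR1 mulr1 -EFinB lee_fin gerBl mulr_ge0// powR_ge0//.
+ apply: derivable_within_continuous => x; rewrite in_itv/= => /andP[nx _].
  have x0 := lt_le_trans n0 nx.
  by have [] := is_derive1_powR (-(1/2)) x0.
+ split.
  * move=> x; rewrite in_itv/= => /andP[nx _].
    by have [] := dF _ (lt_trans n0 nx).
  * apply: cvg_at_right_filter.
    by have [/derivable1_diffP/differentiable_continuous] := dF _ n0.
  * apply: cvg_at_left_filter.
    by have [/derivable1_diffP/differentiable_continuous] := dF _ ltr01.
+ move=> x; rewrite in_itv/= => /andP[nx _].
  have [_ <-] := dF _ (lt_trans n0 nx); by rewrite derive1E.
Qed.

Lemma integral_far_finite : (\int[mu]_(x in `[1%R, +oo[) (x `^ (- (3/2)))%:E = 2%:E)%E.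
Proof.
have dF (x : R) : 0 < x ->
    is_derive x 1 (fun x => - 2 * x `^ (- (1/2))) (x `^ (-(3/2))).
  move=> x0; have := is_derive1_powR (- (1/2)) x0.
  rewrite (_ : - (1/2) - 1 = -(3/2)); last by lra.
  move=> H; apply: trigger_derive => //.
  by rewrite /GRing.scale/= mulrA; field.
rewrite (@ge0_continuous_FTC2y _ _ (fun x => -2 * x `^ (-(1/2))) _ 0)//.
- by rewrite powR1 mulr1 -EFinB; congr EFin; lra.
- by move=> x _; rewrite powR_ge0.
- apply: derivable_within_continuous => x; rewrite in_itv/= andbT => x1.
  by have [] := is_derive1_powR (-(3/2)) (lt_le_trans ltr01 x1).
- rewrite -[X in _ --> X](mulr0 (-2)); apply: cvgM; first exact: cvg_cst.
  apply/cvgr0Pnorm_lt => e e0; near=> x.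
  have x0 : 0 < x by near: x; exact: nbhs_pinfty_gt.
  rewrite ger0_norm ?powR_ge0// powRN div1r powR12_sqrt ?ltW//.
  rewrite invf_plt ?posrE ?sqrtr_gt0//.
  rewrite -(ger0_norm (_ : 0 <= e^-1)) ?invr_ge0 ?(ltW e0)// -sqrtr_sqr ltr_sqrt//.
  by near: x; apply: nbhs_pinfty_gt; rewrite num_real.
- by move=> x x1; have [] := dF _ (lt_trans ltr01 x1).
- apply: cvg_at_right_filter.
  by have [/derivable1_diffP/differentiable_continuous] := dF _ ltr01.
- move=> x; rewrite in_itv/= andbT => x1.
  by have [_ <-] := dF _ (lt_trans ltr01 x1); rewrite derive1E.
Unshelve. all: by end_near. Qed.

Lemma integrable_majorant : mu.-integrable setT (EFin \o majorant).
Proof.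
have mk : measurable_fun setT (EFin \o majorant)
  by apply/measurable_EFinP; exact: measurable_majorant.
apply/integrableP; split => //.
under eq_integral do rewrite gee0_abs ?lee_fin ?majorant_ge0//.
pose k1 : R -> \bar R := ((fun x : R => (x `^ (- (1/2)))%:E) \_ `]0%R, 1%R])%E.
pose k2 : R -> \bar R := ((fun x : R => (x `^ (- (3/2)))%:E) \_ `[1%R, +oo[)%E.
have mp (c : R) : measurable_fun setT (fun x : R => (x `^ c)%:E).
  by apply/measurable_EFinP; exact: measurable_powR.
have m1 : measurable_fun setT k1.
  by apply/(measurable_restrictT _ _).1 => //; apply: measurable_funTS; exact: mp.
have m2 : measurable_fun setT k2.
  by apply/(measurable_restrictT _ _).1 => //; apply: measurable_funTS; exact: mp.
have k10 x : (0 <= k1 x)%E by rewrite /k1 patchE; case: ifP => // _; rewrite lee_fin powR_ge0.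
have k20 x : (0 <= k2 x)%E by rewrite /k2 patchE; case: ifP => // _; rewrite lee_fin powR_ge0.
have i1 : (\int[mu]_x k1 x < +oo)%E.
  by rewrite /k1 -integral_mkcond (le_lt_trans integral_near_finite)// ltry.
have i2 : (\int[mu]_x k2 x < +oo)%E.
  by rewrite /k2 -integral_mkcond integral_far_finite ltry.
have kp x : 0 < x -> ((majorant x)%:E <= k1 x + k2 x)%E.
  move=> x0; have [x1|x1] := leP x 1.
    apply: (@le_trans _ _ (k1 x)); last by rewrite leeDl.
    by rewrite /k1 patchE mem_set/= ?in_itv/= ?x0// lee_fin majorant_le_near.
  apply: (@le_trans _ _ (k2 x)); last by rewrite leeDr.
  rewrite /k2 patchE mem_set/= ?in_itv/= ?andbT ?(ltW x1)//.
  by rewrite lee_fin majorant_le_far.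
have mN (f : R -> \bar R) : measurable_fun setT f -> measurable_fun setT (fun y : R => f (0 - y)).
  by move=> mf; exact: (measurableT_comp mf (measurable_reflect 0)).
apply: (@le_lt_trans _ _ (\int[mu]_x ((k1 x + k2 x) + (k1 (0 - x)%R + k2 (0 - x)%R)))%E).
  apply: ge0_le_integral => //.
  - by move=> x _; rewrite lee_fin majorant_ge0.
  - by apply: emeasurable_funD; [exact: emeasurable_funD|apply: emeasurable_funD; exact: mN].
  - move=> x _; rewrite sub0r; have [x0|x0|->] := ltgtP x 0.
    + rewrite /= -majorantN (le_trans (kp _ _)) ?oppr_gt0// leeDr// adde_ge0//.
    + by rewrite /= (le_trans (kp _ x0))// leeDl// adde_ge0.
    + by rewrite /= /majorant normr0 min_r// mul0r !adde_ge0.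
rewrite ge0_integralD//; last 4 first.
- by move=> x _; rewrite adde_ge0.
- exact: emeasurable_funD.
- by move=> x _; rewrite adde_ge0.
- by apply: emeasurable_funD; exact: mN.
rewrite (@ge0_integral_reflect _ (fun x => k1 x + k2 x)%E); last 2 first.
- exact: emeasurable_funD.
- by move=> x; rewrite adde_ge0.
have k12 : (\int[mu]_x (k1 x + k2 x) < +oo)%E.
  by rewrite ge0_integralD//; exact: lte_add_pinfty.
exact: lte_add_pinfty.
Qed.

End Majorant.

(** * Smooth functions of one variable and Gronwall's inequality *)

Section Smooth.
Context {R : realType}.
Implicit Types f : R -> R.

Lemma smooth_derive1 (V : normedModType R) (f : R -> V) : smooth f -> smooth f^`().
Proof. by move=> sf n x; rewrite -derive1Sn; exact: sf. Qed.

Lemma smooth_is_derive f (x : R) : smooth f -> is_derive x 1 f (f^`() x).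
Proof. by move=> sf; rewrite derive1E; apply: DeriveDef => //; exact: (sf 0%N). Qed.

Lemma is_derive_continuous f (x l : R) : is_derive x 1 f l -> {for x, continuous f}.
Proof. by case=> /derivable1_diffP/differentiable_continuous. Qed.

Lemma smooth_continuous f : smooth f -> continuous f.
Proof. by move=> sf x; exact: is_derive_continuous (smooth_is_derive x sf). Qed.

Lemma continuous_bounded_itv f (a b : R) : {within `[a, b], continuous f} ->
  exists M : R, 0 <= M /\ forall x, x \in `[a, b]%R -> `|f x| <= M.
Proof.
move=> cf; have [ab|ba] := leP a b; last first.
  exists 0; split => // x; rewrite in_itv/= => /andP[ax xb].
  by have := lt_le_trans ba (le_trans ax xb); rewrite ltxx.
have [c _ hc] := EVT_max ab cf; have [d _ hd] := EVT_min ab cf.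
exists (`|f c| + `|f d|); split => [|x xab]; first by rewrite addr_ge0.
have := hc _ xab; have := hd _ xab; have := ler_norm (f c); have := ler_norm (- f d).
rewrite normrN ler_norml; have := normr_ge0 (f c); have := normr_ge0 (f d); lra.
Qed.

Lemma smooth_bounded f (r : R) : smooth f ->
  exists M : R, 0 <= M /\ forall x, `|x| <= r -> `|f x| <= M.
Proof.
move=> sf; have [|M [M0 hM]] := @continuous_bounded_itv f (- r) r.
  by apply: continuous_subspaceT; exact: smooth_continuous.
by exists M; split => // x; rewrite ler_norml => xr; apply: hM; rewrite in_itv.
Qed.

(** The mean value theorem for endpoints in either order, with the position of
    the intermediate point expressed through absolute values. *)
Lemma MVT_abs f (df : R -> R) (a b : R) :
  (forall x : R, is_derive x 1 f (df x)) ->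
  exists c : R, [/\ `|c - a| <= `|b - a|, `|c| <= Num.max `|a| `|b| &
    f b - f a = df c * (b - a)].
Proof.
move=> fdf.
have cf x y : {within `[x, y], continuous f}.
  apply: continuous_subspaceT => z; exact: is_derive_continuous (fdf z).
have mx c : Num.min a b <= c <= Num.max a b -> `|c| <= Num.max `|a| `|b|.
  rewrite ge_min !le_max => /andP[/orP ac /orP cb]; apply/orP.
  have := ler_norm a; have := ler_norm (- a); have := ler_norm b; have := ler_norm (- b).
  rewrite !normrN => b1 b2 a1 a2; have [c0|c0] := leP 0 c.
    by case: cb => ?; [left|right]; rewrite ger0_norm//; lra.
  by case: ac => ?; [left|right]; rewrite ltr0_norm//; lra.
have [ab|/ltW ba] := leP a b.
  have [c cab E] := MVT_segment ab (fun x _ => fdf x) (cf a b).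
  move: cab; rewrite in_itv/= => /andP[ac cb]; exists c; split => //.
    by rewrite !ger0_norm ?subr_ge0// lerB.
  by apply: mx; rewrite ge_min le_max ac cb orbT.
have [c cab E] := MVT_segment ba (fun x _ => fdf x) (cf b a).
move: cab; rewrite in_itv/= => /andP[ac cb]; exists c; split; last by move: E; lra.
  by rewrite !ler0_norm ?subr_le0// lerN2 lerB.
by apply: mx; rewrite ge_min le_max ac cb orbT.
Qed.

Lemma smooth_lipschitz f (r : R) : smooth f -> exists M : R, 0 <= M /\
  forall x y, `|x| <= r -> `|y| <= r -> `|f x - f y| <= M * `|x - y|.
Proof.
move=> sf; have [M [M0 hM]] := smooth_bounded r (smooth_derive1 sf).
exists M; split => // x y xr yr.
wlog xy : x y xr yr / x <= y.
  move=> H; have [|/ltW] := leP x y; first exact: H.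
  by move=> yx; rewrite distrC (distrC x); exact: H.
have cf : {within `[x, y], continuous f}.
  by apply: continuous_subspaceT; exact: smooth_continuous.
have [c] := MVT_segment xy (fun z _ => smooth_is_derive z sf) cf.
rewrite in_itv/= => /andP[xc cy]; rewrite distrC (distrC x) => ->.
rewrite normrM ler_wpM2r// hM// ler_norml.
by move: xr yr; rewrite !ler_norml; lra.
Qed.

End Smooth.

(** Both estimates come from one computation: if |f'| <= Lam |f|, then
    f^2 exp(-2 Lam s) decreases and f^2 exp(2 Lam s) increases. *)
Section Gronwall.
Context {R : realType}.
Variables (f df : R -> R) (t Lam : R).
Hypothesis t0 : 0 <= t.
Hypothesis cf : {within `[0, t], continuous f}.
Hypothesis fdf : forall s, s \in `]0, t[%R -> is_derive s 1 f (df s).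
Hypothesis bound : forall s, s \in `]0, t[%R -> `|df s| <= Lam * `|f s|.

Let weighted_derive (c s : R) : s \in `]0, t[%R ->
  is_derive s 1 (fun s => f s ^+ 2 * expR (c * s))
    ((2 * f s * df s + c * f s ^+ 2) * expR (c * s)).
Proof.
move=> st; have H := fdf st.
have E : is_derive s 1 (fun s => expR (c * s)) (c * expR (c * s)).
  apply: trigger_derive.
  by rewrite /GRing.scale/=; ring.
apply: trigger_derive.
by rewrite /GRing.scale/=; ring.
Qed.

Let weighted_continuous (c : R) :
  {within `[0, t], continuous (fun s => f s ^+ 2 * expR (c * s))}.
Proof.
move=> s; apply: cvgM; last first.
  have : {within `[0, t], continuous (fun s => expR (c * s))}.
    apply: continuous_subspaceT => z.
    apply: (@continuous_comp _ _ _ ( *%R c) expR); first exact: mulrl_continuous.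
    exact: continuous_expR.
  exact.
by apply: cvgM; exact: cf.
Qed.

Let cross s : s \in `]0, t[%R -> `|f s * df s| <= Lam * f s ^+ 2.
Proof.
move=> /bound H; rewrite normrM -(real_normK (num_real (f s))) expr2 mulrCA.
by rewrite ler_wpM2l.
Qed.

Lemma gronwall_le : `|f t| <= expR (Lam * t) * `|f 0|.
Proof.
have := @ler0_derive1_nincr R (fun s => f s ^+ 2 * expR (- (2 * Lam) * s)) 0 t.
move=> /(_ _ _ (@weighted_continuous _) 0 t (lexx _) t0 (lexx _)).
have H s : s \in `]0, t[%R -> (fun s => f s ^+ 2 * expR (- (2 * Lam) * s))^`() s <= 0.
  move=> st; have [_ e] := weighted_derive (- (2 * Lam)) st.
  rewrite derive1E e pmulr_lle0 ?expR_gt0//.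
  by have := cross st; rewrite ler_norml => /andP[_]; lra.
move=> /(_ _ H) {}H.
have {}H : f t ^+ 2 * expR (- (2 * Lam) * t) <= f 0 ^+ 2 * expR (- (2 * Lam) * 0).
  by apply: H => s st; have [] := weighted_derive (- (2 * Lam)) st.
move: H; rewrite mulr0 expR0 mulr1 mulNr expRN ler_pdivrMr ?expR_gt0// => H.
rewrite -(@ler_pXn2r _ 2) ?nnegrE ?mulr_ge0 ?expR_ge0// exprMn !real_normK ?num_real//.
by rewrite -expRM_natl mulrC (le_trans H)// mulrA.
Qed.

Lemma gronwall_neq0 : f 0 != 0 -> f t != 0.
Proof.
move=> f0; have := @ger0_derive1_ndecr R (fun s => f s ^+ 2 * expR ((2 * Lam) * s)) 0 t.
have H s : s \in `]0, t[%R -> 0 <= (fun s => f s ^+ 2 * expR ((2 * Lam) * s))^`() s.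
  move=> st; have [_ e] := weighted_derive (2 * Lam) st.
  rewrite derive1E e mulr_ge0 ?expR_ge0//.
  by have := cross st; rewrite ler_norml => /andP[+ _]; lra.
have dH s : s \in `]0, t[%R -> derivable (fun s => f s ^+ 2 * expR ((2 * Lam) * s)) s 1.
  by move=> st; have [] := weighted_derive (2 * Lam) st.
move=> /(_ dH H (@weighted_continuous _) 0 t (lexx _) t0 (lexx _)).
rewrite mulr0 expR0 mulr1; apply: contraTneq => ->.
by rewrite expr0n/= mul0r -ltNge exprn_even_gt0.
Qed.

End Gronwall.

(** * The flow as a function of the starting point *)

Section FlowLipschitz.
Context {R : realType}.
Variables (X : R -> R) (delta T : R) (phi : R -> R -> R).
Hypotheses (hX : smooth X) (hphi : is_flow X delta phi).
Hypotheses (T0 : 0 < T) (Td : T < delta).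

Lemma flow_derive_time (x s : R) : 0 <= s <= T ->
  is_derive s 1 (phi^~ x) (X (phi s x)).
Proof.
by move=> /andP[s0 sT]; apply: hphi.2; rewrite ger0_norm// (le_lt_trans sT).
Qed.

Lemma flow_continuous_time (x : R) : {within `[0, T], continuous (phi^~ x)}.
Proof.
apply: derivable_within_continuous => s; rewrite in_itv/= => sT.
by have [] := flow_derive_time x sT.
Qed.

Lemma within_sub (f : R -> R) (t : R) : t <= T ->
  {within `[0, T], continuous f} -> {within `[0, t], continuous f}.
Proof. by move=> tT; apply: continuous_subspaceW; apply: subset_itvl; rewrite bnd_simp. Qed.

Lemma flow_diff_gronwall (x z : R) : exists Lam : R, 0 <= Lam /\
  forall s, 0 <= s <= T -> `|X (phi s z) - X (phi s x)| <= Lam * `|phi s z - phi s x|.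
Proof.
have [M [_ hM]] := continuous_bounded_itv (@flow_continuous_time x).
have [N [_ hN]] := continuous_bounded_itv (@flow_continuous_time z).
have [L [L0 hL]] := smooth_lipschitz (Num.max M N) hX.
exists L; split => // s sT; apply: hL.
  by rewrite le_max hN ?orbT// in_itv.
by rewrite le_max hM// in_itv.
Qed.

Lemma flow_diff_derive (x z s : R) : 0 <= s <= T ->
  is_derive s 1 (fun s => phi s z - phi s x) (X (phi s z) - X (phi s x)).
Proof.
move=> sT; have := flow_derive_time x sT; have := flow_derive_time z sT => A B.
exact: is_deriveB.
Qed.

Lemma flow_diff_continuous (x z : R) :
  {within `[0, T], continuous (fun s => phi s z - phi s x)}.
Proof.
apply: derivable_within_continuous => s; rewrite in_itv/= => sT.
by have [] := flow_diff_derive x z sT.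
Qed.

(** Two distinct trajectories never meet, by [gronwall_neq0], so by the
    intermediate value theorem their order is preserved. *)
Lemma flow_lt (x z t : R) : 0 <= t <= T -> x < z -> phi t x < phi t z.
Proof.
move=> /andP[t0 tT] xz; rewrite -subr_gt0.
have [Lam [_ hLam]] := flow_diff_gronwall x z.
have neq s : 0 <= s <= T -> phi s z - phi s x != 0.
  move=> /andP[s0 sT].
  apply: (@gronwall_neq0 _ (fun s => phi s z - phi s x)
    (fun s => X (phi s z) - X (phi s x)) s Lam) => //.
  - exact: within_sub sT (@flow_diff_continuous x z).
  - move=> r; rewrite in_itv/= => /andP[r0 rs]; apply: flow_diff_derive.
    by rewrite (ltW r0) (le_trans (ltW rs)).
  - move=> r; rewrite in_itv/= => /andP[r0 rs]; apply: hLam.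
    by rewrite (ltW r0) (le_trans (ltW rs)).
  - by rewrite !hphi.1 subr_eq0 gt_eqF.
rewrite lt_neqAle eq_sym neq ?t0//= leNgt; apply/negP => neg.
have [||c] := @IVT _ (fun s => phi s z - phi s x) 0 t 0 t0.
- exact: within_sub tT (@flow_diff_continuous x z).
- by rewrite !hphi.1 ge_min le_max subr_ge0 (ltW xz) (ltW neg) orbT.
rewrite in_itv/= => /andP[c0 ct] /eqP; apply/negP/neq.
by rewrite c0 (le_trans ct).
Qed.

Lemma flow_le (x z t : R) : 0 <= t <= T -> x <= z -> phi t x <= phi t z.
Proof.
by move=> tT; rewrite le_eqVlt => /predU1P[->//|/(flow_lt tT)/ltW].
Qed.

(** By monotonicity the trajectories issued from [-r, r] are trapped between the
    two issued from the endpoints. *)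
Lemma flow_bounded (r : R) : exists M : R, 0 <= M /\
  forall s x, 0 <= s <= T -> `|x| <= r -> `|phi s x| <= M.
Proof.
have [M [M0 hM]] := continuous_bounded_itv (@flow_continuous_time (- r)).
have [N [N0 hN]] := continuous_bounded_itv (@flow_continuous_time r).
exists (M + N); split; first exact: addr_ge0.
move=> s x sT; rewrite ler_norml => /andP[rx xr].
have st : s \in `[0, T]%R by rewrite in_itv.
have := hM _ st; have := hN _ st; have := flow_le sT rx; have := flow_le sT xr.
by rewrite !ler_norml; lra.
Qed.

Lemma flow_lipschitz (r : R) : exists K : R, 0 <= K /\
  forall s x z, 0 <= s <= T -> `|x| <= r -> `|z| <= r ->
    `|phi s z - phi s x| <= K * `|z - x|.
Proof.
have [M [M0 hM]] := flow_bounded r.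
have [L [L0 hL]] := smooth_lipschitz M hX.
exists (expR (L * T)); split; first exact: expR_ge0.
move=> s x z /andP[s0 sT] xr zr.
have := @gronwall_le _ (fun s => phi s z - phi s x)
    (fun s => X (phi s z) - X (phi s x)) s L s0.
rewrite !hphi.1 => H; apply: le_trans (H _ _ _) _.
- exact: within_sub sT (@flow_diff_continuous x z).
- move=> q; rewrite in_itv/= => /andP[q0 qs]; apply: flow_diff_derive.
  by rewrite (ltW q0) (le_trans (ltW qs)).
- move=> q; rewrite in_itv/= => /andP[q0 qs].
  have qT : 0 <= q <= T by rewrite (ltW q0) (le_trans (ltW qs)).
  by apply: hL; exact: hM.
by rewrite ler_wpM2r// ler_expR ler_wpM2l.
Qed.

Let logder (s x : R) := derive1 X (phi s x).

Lemma logder_continuous (x : R) : {within `[0, T], continuous (logder^~ x)}.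
Proof.
apply: derivable_within_continuous => s; rewrite in_itv/= => sT.
have A := flow_derive_time x sT.
have B := smooth_is_derive (phi s x) (smooth_derive1 hX).
apply/derivable1_diffP; apply: differentiable_comp; apply/derivable1_diffP.
  by case: A.
by case: B.
Qed.

(** The solution of the linearised equation J' = X'(phi) J with J(0) = 1, which
    is the derivative of phi_t with respect to the starting point. *)
Definition flow_jacobian (t x : R) : R :=
  expR (\int[lebesgue_measure]_(s in `[0, t]) derive1 X (phi s x)).

Let logder_integrable (t x : R) : t <= T ->
  lebesgue_measure.-integrable `[0, t] (EFin \o (logder^~ x)).
Proof.
move=> tT; apply: continuous_compact_integrable; first exact: segment_compact.
exact: within_sub tT (@logder_continuous x).
Qed.

Lemma logjac_continuous (x : R) :
  {within `[0, T], continuous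
    (fun t : R => \int[lebesgue_measure]_(s in `[0, t]) derive1 X (phi s x))}.
Proof. exact: (parameterized_integral_continuous (ltW T0) (logder_integrable x (lexx T))). Qed.

Lemma logjac_derive (t x : R) : 0 < t < T ->
  is_derive t 1 (fun t : R => \int[lebesgue_measure]_(s in `[0, t]) derive1 X (phi s x))
    (derive1 X (phi t x)).
Proof.
move=> /andP[t0 tT].
have [] := @continuous_FTC1_closed _ (logder^~ x) 0 t T tT (logder_integrable x (lexx T)) t0.
  have := @logder_continuous x => /(continuous_within_itvP _ T0)[+ _ _]; apply.
  by rewrite in_itv/= t0 tT.
by rewrite derive1E => A B; apply: DeriveDef.
Qed.

(** The logarithm of (phi_s(x + h) - phi_s(x)) / h vanishes at s = 0 and has
    derivative X'(xi) with xi between the two trajectories, hence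
    X'(phi_s(x)) + O(h) uniformly in s. Integrating in s, the logarithm of the
    difference quotient at time t converges to int_0^t X'(phi_s(x)) ds. *)
Lemma flow_derive_space (t x : R) : 0 <= t <= T ->
  is_derive x 1 (phi t) (flow_jacobian t x).
Proof.
move=> /andP[t0 tT].
set J := fun t : R => \int[lebesgue_measure]_(s in `[0, t]) derive1 X (phi s x).
have [M [M0 hM]] := flow_bounded (`|x| + 1).
have [K [K0 hK]] := flow_lipschitz (`|x| + 1).
have [A [A0 hA]] := smooth_lipschitz M (smooth_derive1 hX).
(* The quotient is positive for h of either sign, because the flow is
   increasing. *)
pose ell (h s : R) := ln ((phi s (x + h) - phi s x) / h).
have main (h : R) : h != 0 -> `|h| <= 1 -> 0 < (phi t (x + h) - phi t x) / h /\
   `|ell h t - J t| <= A * K * T * `|h|.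
  move=> h0 h1.
  have pos s : 0 <= s <= T -> 0 < (phi s (x + h) - phi s x) / h.
    move=> sT; have [h_lt0|h_gt0|] := ltgtP h 0; last by move/eqP; rewrite (negbTE h0).
      rewrite -mulrNN -invrN mulr_gt0 ?invr_gt0 ?oppr_gt0// subr_lt0.
      by apply: flow_lt => //; rewrite gtrDl.
    by rewrite mulr_gt0 ?invr_gt0// subr_gt0; apply: flow_lt => //; rewrite ltrDl.
  have xr : `|x| <= `|x| + 1 by rewrite lerDl.
  have xhr : `|x + h| <= `|x| + 1 by rewrite (le_trans (ler_normD _ _))// lerD2l.
  split; first by apply: pos; rewrite t0.
  have dell s : 0 <= s <= T -> is_derive s 1 (ell h)
      ((X (phi s (x + h)) - X (phi s x)) / (phi s (x + h) - phi s x)).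
    move=> sT; have ps := pos _ sT.
    have D := flow_diff_derive x (x + h) sT.
    have dln := is_derive1_ln ps.
    have D2 : is_derive s 1 (fun s => (phi s (x + h) - phi s x) / h)
      ((X (phi s (x + h)) - X (phi s x)) / h).
      apply: trigger_derive; rewrite /GRing.scale/=; ring.
    apply: trigger_derive.
    have : phi s (x + h) - phi s x != 0.
      by apply: contraTneq ps => ->; rewrite mul0r ltxx.
    by move=> ne; rewrite /GRing.scale/=; field; rewrite ne h0.
  have [->|tn0] := eqVneq t 0.
    rewrite /ell /J !hphi.1 addrAC subrr add0r divff// ln1 set_itv1 Rintegral_set1.
    by rewrite subrr normr0 !mulr_ge0// ltW.
  have {}t0 : 0 < t by rewrite lt_neqAle eq_sym tn0.
  have [||c] := @MVT _ (fun s => ell h s - J s)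
     (fun s => (X (phi s (x + h)) - X (phi s x)) / (phi s (x + h) - phi s x) -
       derive1 X (phi s x)) _ _ t0.
  - move=> s; rewrite in_itv/= => /andP[s0 st].
    have sT := lt_le_trans st tT.
    have a := @dell s; have b := @logjac_derive s x.
    apply: is_deriveB; first by apply: a; rewrite !ltW.
    by apply: b; rewrite s0.
  - apply: (@within_sub _ t) => //; apply: within_continuousB.
      apply: derivable_within_continuous => s; rewrite in_itv/= => sT.
      by have [] := dell s sT.
    exact: logjac_continuous.
  rewrite in_itv/= => /andP[c0 ct].
  have -> : ell h 0 - J 0 = 0.
    rewrite /ell /J !hphi.1 addrAC subrr add0r divff// ln1 set_itv1 Rintegral_set1.
    by rewrite subrr.
  rewrite !subr0 => ->.
  have cT : 0 <= c <= T by rewrite (ltW c0) (le_trans (ltW ct)).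
  rewrite normrM (ger0_norm (ltW t0)).
  have [xi [xiI xiM E]] := MVT_abs (phi c x) (phi c (x + h))
    (fun z => smooth_is_derive z hX).
  have ne : phi c (x + h) - phi c x != 0.
    by apply: contraTneq (pos _ cT) => ->; rewrite mul0r ltxx.
  rewrite E mulfK//.
  have lh := hK _ _ _ cT xr xhr; rewrite addrAC subrr add0r in lh.
  have bx := hM _ _ cT xr; have bxh := hM _ _ cT xhr.
  have xiM' : `|xi| <= M by rewrite (le_trans xiM)// ge_max bx bxh.
  apply: (@le_trans _ _ (A * K * `|h| * T)); last by rewrite -!mulrA (mulrC T).
  apply: ler_pM => //; first exact: ltW.
  rewrite (le_trans (hA _ _ xiM' bx))// -mulrA ler_wpM2l// (le_trans xiI)//.
have cv : h^-1 *: (phi t (h *: 1 + x) - phi t x) @[h --> 0^'] --> flow_jacobian t x.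
  have -> : flow_jacobian t x = expR (J t) by [].
  apply: (@cvg_trans _ ((expR (ell h t)) @[h --> 0^'])).
    apply: near_eq_cvg; near=> h.
    have h0 : h != 0 by near: h; exact: nbhs_dnbhs_neq.
    have h1 : `|h| <= 1 by near: h; apply: dnbhs0_le.
    have [ps _] := main _ h0 h1.
    by rewrite lnK// [h *: 1]mulr1 [h + x]addrC /GRing.scale/= mulrC.
  apply: (@cvg_comp _ _ _ (ell^~ t) expR _ (nbhs (J t))); last exact: continuous_expR.
  have C0 : 0 <= A * K * T by rewrite !mulr_ge0// ltW.
  apply/cvgrPdist_le => e e0; near=> h.
  have h0 : h != 0 by near: h; exact: nbhs_dnbhs_neq.
  have h1 : `|h| <= 1 by near: h; apply: dnbhs0_le.
  have [_ le] := main _ h0 h1; rewrite distrC (le_trans le)//.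
  have he : `|h| <= e / (A * K * T + 1).
    by near: h; apply: dnbhs0_le; rewrite divr_gt0// ltr_wpDl ?C0.
  rewrite (le_trans (ler_wpM2l C0 he))// mulrA ler_pdivrMr ?ltr_wpDl//.
  by rewrite mulrC ler_wpM2l ?(ltW e0)// lerDl.
by apply: DeriveDef; [apply/cvg_ex; exists (flow_jacobian t x)|exact: cvg_lim].
Unshelve. all: by end_near. Qed.

End FlowLipschitz.

(** * Smoothness of the flow *)

Section TameFamilies.
Context {R : realType}.
Variable T : R.
Implicit Types g h : R -> R -> R.

(** Separate continuity in time and local boundedness suffice to differentiate
    time integrals under the integral sign; joint continuity is not tracked. *)
Definition tame g : Prop :=
  (forall x, {within `[0, T], continuous (g^~ x)}) /\
  (forall r : R, exists M : R, forall s x : R, 0 <= s <= T -> `|x| <= r -> `|g s x| <= M).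

(** Families that are n times differentiable in the space variable, all the
    derivatives being tame. The class is stable under the operations through
    which the flow enters its own derivative: products, composition with smooth
    functions, and integration in time. *)
Fixpoint tameC (n : nat) g : Prop :=
  tame g /\
  if n is n'.+1 then
    exists g', (forall s x : R, 0 <= s <= T -> is_derive x 1 (g s) (g' s x)) /\
      tameC n' g'
  else True.

Lemma tameC_tame n g : tameC n g -> tame g.
Proof. by case: n => [|n] []. Qed.

Lemma tameC_pred n g : tameC n.+1 g -> tameC n g.
Proof.
elim: n g => [|n IH] g; first by case.
by move=> [tg [g' [dg /IH]]]; split => //; exists g'.
Qed.

Lemma tameD g h : tame g -> tame h -> tame (fun s x => g s x + h s x).
Proof.
move=> [cg bg] [ch bh]; split=> [x|r].
  by apply: within_continuousD; [exact: cg|exact: ch].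
have [M hM] := bg r; have [N hN] := bh r; exists (M + N) => s x sT xr.
by rewrite (le_trans (ler_normD _ _))// lerD// ?hM ?hN.
Qed.

Lemma tameM g h : tame g -> tame h -> tame (fun s x => g s x * h s x).
Proof.
move=> [cg bg] [ch bh]; split=> [x s|r].
  by apply: cvgM; [exact: cg|exact: ch].
have [M hM] := bg r; have [N hN] := bh r; exists (M * N) => s x sT xr.
by rewrite normrM ler_pM// ?hM ?hN.
Qed.

Lemma tameC_D n g h : tameC n g -> tameC n h -> tameC n (fun s x => g s x + h s x).
Proof.
elim: n g h => [|n IH] g h.
  by move=> [tg _] [th _]; split => //; exact: tameD.
move=> [tg [g' [dg ng]]] [th [h' [dh nh]]]; split; first exact: tameD.
exists (fun s x => g' s x + h' s x); split; last exact: IH.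
by move=> s x sT; have A := dg s x sT; have B := dh s x sT; exact: is_deriveD.
Qed.

Lemma tameC_M n g h : tameC n g -> tameC n h -> tameC n (fun s x => g s x * h s x).
Proof.
elim: n g h => [|n IH] g h.
  by move=> [tg _] [th _]; split => //; exact: tameM.
move=> Hg Hh; have [tg [g' [dg ng]]] := Hg; have [th [h' [dh nh]]] := Hh.
split; first exact: tameM.
exists (fun s x => g s x * h' s x + g' s x * h s x); split.
  move=> s x sT; have A := dg s x sT; have B := dh s x sT.
  by apply: trigger_derive; rewrite /GRing.scale/=; ring.
by apply: tameC_D; apply: IH => //; exact: tameC_pred.
Qed.

Lemma tame_comp (f : R -> R) g : smooth f -> tame g -> tame (fun s x => f (g s x)).
Proof.
move=> sf [cg bg]; split=> [x s|r].
  apply: (@cvg_comp _ _ _ (g^~ x) f _ (nbhs (g s x))); first exact: cg.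
  exact: (@smooth_continuous _ f sf (g s x)).
have [M hM] := bg r; have [N [_ hN]] := smooth_bounded M sf; exists N => s x sT xr.
by apply: hN; exact: hM.
Qed.

Lemma tameC_comp n (f : R -> R) g : smooth f -> tameC n g -> tameC n (fun s x => f (g s x)).
Proof.
elim: n f g => [|n IH] f g sf.
  by move=> [tg _]; split => //; exact: tame_comp.
move=> Hg; have [tg [g' [dg ng]]] := Hg.
split; first exact: tame_comp.
exists (fun s x => g' s x * derive1 f (g s x)); split.
  move=> s x sT; have A := dg s x sT; have B := smooth_is_derive (g s x) sf.
  by apply: trigger_derive; rewrite /GRing.scale/=; ring.
by apply: tameC_M => //; apply: IH; [exact: smooth_derive1|exact: tameC_pred].
Qed.

Lemma tameC_smooth g : (forall n, tameC n g) -> forall t, 0 <= t <= T -> smooth (g t).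
Proof.
move=> H t tT n; move: (H n.+1) => {H}.
elim: n g => [|n IH] g [tg [g' [dg ng]]] x; first by have [] := dg t x tT.
rewrite derive1Sn (_ : (g t)^`() = g' t); first exact: IH.
by apply/funext => y; rewrite derive1E; have [] := dg t y tT.
Qed.

Lemma smooth_tameC n (f : R -> R) : smooth f -> tameC n (fun _ => f).
Proof.
elim: n f => [|n IH] f sf; (split; [split=> [x|r]|]) => //.
- by apply: continuous_subspaceT => s; exact: cvg_cst.
- by have [M [_ hM]] := smooth_bounded r sf; exists M => s x _; exact: hM.
- by apply: continuous_subspaceT => s; exact: cvg_cst.
- by have [M [_ hM]] := smooth_bounded r sf; exists M => s x _; exact: hM.
exists (fun _ => derive1 f); split; last by apply: IH; exact: smooth_derive1.
by move=> s x _; exact: smooth_is_derive.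
Qed.

Hypothesis T0 : 0 <= T.

Local Notation mu := (@lebesgue_measure R).

Lemma tame_integrable g t x : tame g -> t <= T ->
  mu.-integrable `[0, t] (EFin \o g^~ x).
Proof.
move=> [cg _] tT; apply: continuous_compact_integrable; first exact: segment_compact.
exact: (within_sub tT (cg x)).
Qed.

Lemma tame_integral g : tame g -> tame (fun t x => \int[mu]_(s in `[0, t]) g s x).
Proof.
move=> tg; split=> [x|r].
  exact: (parameterized_integral_continuous T0 (tame_integrable x tg (lexx T))).
have [M hM] := tg.2 r; exists (M * T) => t x /andP[t0 tT] xr.
have M0 : 0 <= M by rewrite (le_trans _ (hM 0 x _ xr))// lexx.
apply: (le_trans (le_normr_Rintegral _ _)) => //; first exact: tame_integrable.
apply: (@le_trans _ _ (\int[mu]_(s in `[0, t]) M)).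
  apply: le_Rintegral => //.
  - by apply: integrable_norm; exact: tame_integrable.
  - apply: continuous_compact_integrable; first exact: segment_compact.
    by apply: continuous_subspaceT => s; exact: cvg_cst.
  - move=> s /=; rewrite in_itv/= => /andP[s0 st].
    by apply: hM => //; rewrite s0 (le_trans st).
rewrite Rintegral_cst//= lebesgue_measure_itv/= lte_fin.
by case: ifP => _; rewrite ?mulr0 ?mulr_ge0//= oppr0 addr0 ler_wpM2l.
Qed.

Lemma tameC_integral n g : tameC n g ->
  tameC n (fun t x => \int[mu]_(s in `[0, t]) g s x).
Proof.
elim: n g => [|n IH] g.
  by move=> [tg _]; split => //; exact: tame_integral.
move=> Hg; have [tg [g' [dg ng]]] := Hg; split; first exact: tame_integral.
exists (fun t x => \int[mu]_(s in `[0, t]) g' s x); split; last exact: IH.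
move=> t x /andP[t0 tT].
have tg' := tameC_tame ng.
have [M hM] := tg'.2 (`|x| + 1).
have st (s : R) : `[0, t]%classic s -> 0 <= s <= T.
  by rewrite /= in_itv/= => /andP[-> st]; rewrite (le_trans st).
have M0 : 0 <= M by rewrite (le_trans _ (hM 0 x _ _))// ?lexx// lerDl.
have xI : `]x - 1, x + 1[%classic x by rewrite /= in_itv/= ltrBlDr ltrDl ltr01.
have d1 (z s : R) : `[0, t]%classic s -> partial1of2 (fun x s => g s x) z s = g' s z.
  by move=> /st sT; rewrite partial1of2E; have [] := dg s z sT.
have H1 (z : R) : `]x - 1, x + 1[%classic z -> mu.-integrable `[0, t] (EFin \o g^~ z).
  by move=> _; exact: tame_integrable.
have H2 (z s : R) : `]x - 1, x + 1[%classic z -> `[0, t]%classic s ->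
    derivable ((fun x s => g s x)^~ s) z 1.
  by move=> _ /st sT; have [] := dg s z sT.
have H3 : mu.-integrable `[0, t] (EFin \o cst M).
  apply: continuous_compact_integrable; first exact: segment_compact.
  by apply: continuous_subspaceT => s; exact: cvg_cst.
have H4 (z s : R) : `]x - 1, x + 1[%classic z -> `[0, t]%classic s ->
    `|partial1of2 (fun x s => g s x) z s| <= cst M s.
  move=> /=; rewrite in_itv/= => zx s0t; rewrite d1//; apply: hM; first exact: st.
  rewrite -[z](subrK x) (le_trans (ler_normD _ _))// addrC lerD2l ler_norml; lra.
have mt : measurable (`[0, t]%classic : set (measurableTypeR R)) by [].
have D := @derivable_under_integral _ _ _ mu (fun x s => g s x) _ mt x _ _ xI H1 H2 (cst M)
  (fun _ => M0) H3 H4.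
have E := @differentiation_under_integral _ _ _ mu (fun x s => g s x) _ mt x _ _ xI H1 H2 (cst M)
  (fun _ => M0) H3 H4.
apply: DeriveDef => //; rewrite -derive1E E.
by apply: eq_Rintegral => s /set_mem s0t; rewrite -d1.
Qed.

End TameFamilies.

(** A smooth function is a tame family that does not depend on time. *)
Lemma smoothM (R : realType) (f g : R -> R) : smooth f -> smooth g -> smooth (f \* g).
Proof.
move=> sf sg; apply: (@tameC_smooth R 0 (fun _ => f \* g) _ 0); last by rewrite lexx.
by move=> n; exact: (@tameC_M R 0 n (fun _ => f) (fun _ => g)
  (smooth_tameC 0 n sf) (smooth_tameC 0 n sg)).
Qed.

Lemma smooth_expR (R : realType) : smooth (@expR R).
Proof.
move=> n x; rewrite (_ : expR^`(n) = expR) ?derivable_expR//.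
elim: n => // n IH; rewrite derive1nS IH; apply/funext => y.
by rewrite derive1E; have [_ ->] := @is_derive_expR R y.
Qed.

Section FlowSmooth.
Context {R : realType}.
Variables (X : R -> R) (delta T : R) (phi : R -> R -> R).
Hypotheses (hX : smooth X) (hphi : is_flow X delta phi).
Hypotheses (T0 : 0 < T) (Td : T < delta).

Lemma flow_tame : tame T phi.
Proof.
split=> [x|r]; first exact: (flow_continuous_time hphi).
by have [M [_ hM]] := flow_bounded hX hphi Td r; exists M.
Qed.

(** Bootstrap: if phi is n times differentiable, then so is
    exp (int_0^t X'(phi_s) ds), which is the derivative of phi. *)
Lemma flow_tameC n : tameC T n phi.
Proof.
elim: n => [|n IH]; first by split => //; exact: flow_tame.
split; first exact: flow_tame.
exists (flow_jacobian X phi); split.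
  by move=> s x sT; exact: (flow_derive_space hX hphi T0 Td).
apply: (tameC_comp (@smooth_expR R)).
apply: tameC_integral; first exact: ltW.
by apply: (tameC_comp (smooth_derive1 hX)).
Qed.

Lemma flow_jacobian_tame : tame T (flow_jacobian X phi).
Proof.
apply: (tame_comp (@smooth_expR R)); apply: tame_integral; first exact: ltW.
by apply: (tame_comp (smooth_derive1 hX)); exact: flow_tame.
Qed.

Lemma flow_comp_smooth (f : R -> R) t : smooth f -> 0 <= t <= T -> smooth (f \o phi t).
Proof.
move=> sf tT; apply: (@tameC_smooth _ T (fun t => f \o phi t)) => // n.
by apply: (tameC_comp sf); exact: flow_tameC.
Qed.

Lemma flow_derive1 t x : 0 <= t <= T -> (phi t)^`() x = flow_jacobian X phi t x.
Proof.
by move=> tT; rewrite derive1E; have [] := flow_derive_space hX hphi T0 Td x tT.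
Qed.

Lemma flow_jacobian0 x : flow_jacobian X phi 0 x = 1.
Proof. by rewrite /flow_jacobian set_itv1 Rintegral_set1 expR0. Qed.

End FlowSmooth.

(** * The quarter Laplacian on smooth functions with compact support *)

Section CompactSupport.
Context {R : realType}.
Local Notation mu := (@lebesgue_measure R).

Definition vanishes_beyond (V : normedModType R) (M : R) (f : R -> V) : Prop :=
  forall x, M < `|x| -> f x = 0.

Lemma Cc_infty_vanishes (V : normedModType R) (f : R -> V) : Cc_infty f ->
  exists2 M : R, 0 <= M & vanishes_beyond M f.
Proof.
move=> [_ /compact_bounded[M [_ hM]]].
exists (Num.max 0 (M + 1)) => [|x]; first by rewrite le_max lexx.
rewrite gt_max => /andP[_ Mx]; apply: contra_ltP Mx => fx.
apply: hM; first by rewrite ltrDl.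
by apply: subset_closure; exact/eqP.
Qed.

Lemma vanishes_derive1 (V : normedModType R) M (f : R -> V) :
  vanishes_beyond M f -> vanishes_beyond M f^`().
Proof.
move=> vf x Mx; rewrite derive1E (@near_eq_derive _ _ _ f (cst 0)).
  by rewrite derive_cst.
have : \forall y \near x, M < `|y|.
  have := @norm_continuous _ R x => /cvgr_gt; exact.
by apply: filterS => y; exact: vf.
Qed.

Lemma vanishes_derive1n (V : normedModType R) M (f : R -> V) n :
  vanishes_beyond M f -> vanishes_beyond M f^`(n).
Proof. move=> vf; elim: n => [|n IH]; first exact: vf.
rewrite derive1nS; exact: (vanishes_derive1 IH). Qed.

Lemma smooth_derive1n (f : R -> R) n : smooth f -> smooth f^`(n).
Proof. move=> sf; elim: n => [|n IH]; first exact: sf.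
rewrite derive1nS; exact: (smooth_derive1 IH). Qed.

Lemma vanishes_schwartz M (f : R -> R) : smooth f -> vanishes_beyond M f -> schwartz f.
Proof.
move=> sf vf; split => // k n.
have [B [B0 hB]] := smooth_bounded M (@smooth_derive1n f n sf).
exists (`|M| ^+ k * B) => x; have [xM|Mx] := leP `|x| M.
  apply: ler_pM => //; last exact: hB.
  by rewrite lerXn2r ?nnegrE// (le_trans xM) ?ler_norm.
by rewrite (@vanishes_derive1n _ M f n vf)// normr0 mulr0 mulr_ge0 ?exprn_ge0.
Qed.

Lemma vanishes_bounded M (f : R -> R) : smooth f -> vanishes_beyond M f ->
  exists B : R, 0 <= B /\ forall x, `|f x| <= B.
Proof.
move=> sf vf; have [B [B0 hB]] := smooth_bounded M sf; exists B; split => // x.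
by have [/hB//|Mx] := leP `|x| M; rewrite vf// normr0.
Qed.

(** The bound that makes the singular integral absolutely convergent: increments
    are bounded because the function is, and Lipschitz because its derivative
    is bounded. *)
Lemma vanishes_modulus M (f : R -> R) : smooth f -> vanishes_beyond M f ->
  exists C : R, 0 <= C /\ forall x y, `|f x - f y| <= C * Num.min 1 `|x - y|.
Proof.
move=> sf vf; have [B [B0 hB]] := vanishes_bounded sf vf.
have [D [D0 hD]] := vanishes_bounded (smooth_derive1 sf) (vanishes_derive1 vf).
exists (B + B + D); split => [|x y]; first by rewrite !addr_ge0.
have BBD : 0 <= B + B + D by rewrite !addr_ge0.
have [xy|xy] := leP 1 `|x - y|.
  rewrite mulr1 (le_trans (ler_normB _ _))//.
  by rewrite -[leLHS]addr0 lerD// lerD.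
have [c [_ _ ->]] := MVT_abs y x (fun z => smooth_is_derive z sf).
rewrite normrM ler_wpM2r// (le_trans (hD c))// lerDr addr_ge0//.
Qed.

Lemma singular_le_majorant (C d h : R) : `|d| <= C * Num.min 1 `|h| ->
  `|d / `|h| `^ (3 / 2)| <= C * majorant h.
Proof.
move=> dC; rewrite /majorant mulrA normrM normfV (ger0_norm (powR_ge0 _ _)).
by rewrite ler_wpM2r// invr_ge0 powR_ge0.
Qed.

Lemma integrable_majorant_at (C x : R) :
  mu.-integrable setT (fun y => (C * majorant (x - y))%:E).
Proof.
under eq_fun do rewrite EFinM.
by apply: integrableZl => //; apply: (@integrable_reflect _ majorant); exact: integrable_majorant.
Qed.

Lemma integrable_singular (d : R -> R) (C x : R) : measurable_fun setT d ->
  (forall y, `|d y| <= C * Num.min 1 `|x - y|) ->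
  mu.-integrable setT (fun y => (d y / `|x - y| `^ (3 / 2))%:E).
Proof.
move=> md dC; apply: (le_integrable _ _ _ (integrable_majorant_at C x)) => //.
  by apply/measurable_EFinP; exact: measurable_quotient_powR.
by move=> y _ /=; rewrite lee_fin (le_trans (singular_le_majorant (dC y)))// ler_norm.
Qed.

Lemma measurable_singular0 (d : R -> R) : measurable_fun setT d ->
  measurable_fun setT (fun h => d h / `|h| `^ (3 / 2)).
Proof.
move=> md; rewrite (_ : (fun h => _) = fun h => d h / `|0 - h| `^ (3 / 2)).
  exact: measurable_quotient_powR.
by apply/funext => h; rewrite sub0r normrN.
Qed.

Lemma integrable_singular0 (d : R -> R) (C : R) : measurable_fun setT d ->
  (forall h, `|d h| <= C * Num.min 1 `|h|) ->
  mu.-integrable setT (fun h => (d h / `|h| `^ (3 / 2))%:E).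
Proof.
move=> md dC.
rewrite (_ : (fun h => _) = fun h => (d h / `|0 - h| `^ (3 / 2))%:E).
  by apply: (integrable_singular (C := C)) => // h; rewrite sub0r normrN.
by apply/funext => h; rewrite sub0r normrN.
Qed.

Lemma measurable_smooth (f : R -> R) : smooth f -> measurable_fun setT f.
Proof. by move=> sf; apply: continuous_measurable_fun; exact: smooth_continuous. Qed.

Lemma smooth_coord m (u : R -> 'rV[R]_m) i : smooth u ->
  smooth (fun y => u y 0 i) /\
  forall y, (fun y => u y 0 i)^`() y = (derive1 u y) 0 i.
Proof.
move=> su.
have E n : (fun y => u y 0 i)^`(n) = fun y => (u^`(n) y) 0 i.
  elim: n => // n IH; rewrite !derive1nS IH; apply/funext => y.
  by rewrite !derive1E derive_mx ?mxE//; exact: su.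
split=> [n x|y]; first by rewrite E; have /derivable_mxP := su n x; apply.
by have := E 1%N; rewrite !derive1n1 => ->.
Qed.

Lemma vanishes_coord m (u : R -> 'rV[R]_m) i M :
  vanishes_beyond M u -> vanishes_beyond M (fun y => u y 0 i).
Proof. by move=> vu x /vu ->; rewrite mxE. Qed.

End CompactSupport.

Section QuarterLaplacian.
Context {R : realType}.
Variables (C14 : R) (hC14 : is_C_1_quarter C14).
Local Notation mu := (@lebesgue_measure R).

Lemma qlapE M (v : R -> R) x : smooth v -> vanishes_beyond M v ->
  qlap v x = C14 * \int[mu]_y ((v x - v y) / `|x - y| `^ (3 / 2)).
Proof. by move=> sv vv; apply: hC14; exact: vanishes_schwartz vv. Qed.

Lemma integrable_qlap M (v : R -> R) x : smooth v -> vanishes_beyond M v ->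
  mu.-integrable setT (fun y => ((v x - v y) / `|x - y| `^ (3 / 2))%:E).
Proof.
move=> sv vv; have [C [_ hC]] := vanishes_modulus sv vv.
apply: (@integrable_singular _ _ C) => // .
by apply: measurable_funB => //; exact: measurable_smooth.
Qed.

(** The bound does not depend on x because the integral of the majorant centred
    at x does not. *)
Lemma qlap_bounded M (v : R -> R) : smooth v -> vanishes_beyond M v ->
  exists B : R, 0 <= B /\ forall x, `|qlap v x| <= B.
Proof.
move=> sv vv; have [C [C0 hC]] := vanishes_modulus sv vv.
exists (`|C14| * (C * \int[mu]_y majorant y)); split=> [|x].
  by rewrite !mulr_ge0// Rintegral_ge0// => y _; exact: majorant_ge0.
rewrite (qlapE _ sv vv) normrM ler_wpM2l//.
rewrite (le_trans (le_normr_Rintegral _ (integrable_qlap x sv vv)))//.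
rewrite -(Rintegral_reflect x (@measurable_majorant R)) -RintegralZl//; last first.
  by have := integrable_majorant_at 1 x; under eq_fun do rewrite mul1r.
apply: le_Rintegral => //.
- by apply: integrable_norm; exact: (integrable_qlap x sv vv).
- exact: integrable_majorant_at.
- by move=> y _; exact: singular_le_majorant.
Qed.

Lemma qlap_convolution M (v : R -> R) x : smooth v -> vanishes_beyond M v ->
  qlap v x = C14 * \int[mu]_h ((v x - v (x - h)) / `|h| `^ (3 / 2)).
Proof.
move=> sv vv; apply: (etrans (qlapE x sv vv)); apply: (congr1 ( *%R C14)).
rewrite -(@Rintegral_reflect _ (fun h => (v x - v (x - h)) / `|h| `^ (3 / 2)) x).
  by apply: eq_Rintegral => y _; rewrite (subKr x y).
apply: measurable_singular0.
apply: measurable_funB => //; apply: (measurableT_comp (measurable_smooth sv)).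
exact: measurable_funB.
Qed.

(** In the convolution form x occurs only in the numerator, so differentiation
    under the integral sign amounts to replacing v by v'. *)
Lemma qlap_derive M (v : R -> R) (x : R) : smooth v -> vanishes_beyond M v ->
  is_derive x 1 (qlap v) (qlap (derive1 v) x).
Proof.
move=> sv vv; have sv' := smooth_derive1 sv; have vv' := vanishes_derive1 vv.
have [C [C0 hC]] := vanishes_modulus sv' vv'.
pose f (z h : R) := (v z - v (z - h)) / `|h| `^ (3 / 2).
pose f' (z h : R) := (derive1 v z - derive1 v (z - h)) / `|h| `^ (3 / 2).
have df (z h : R) : is_derive z 1 (f ^~ h) (f' z h).
  have A := smooth_is_derive z sv.
  have B : is_derive z 1 (fun z => v (z - h)) (derive1 v (z - h)).
    have D := smooth_is_derive (z - h) sv.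
    by apply: trigger_derive; rewrite /GRing.scale/=; ring.
  by apply: trigger_derive; rewrite /GRing.scale/= /f'; ring.
have -> : qlap v = fun z => C14 * \int[mu]_h f z h.
  by apply/funext => z; rewrite (qlap_convolution _ sv vv).
rewrite (qlap_convolution x sv' vv').
have d1 (z h : R) : partial1of2 f z h = f' z h.
  by rewrite partial1of2E; have [] := df z h.
have xI : `]x - 1, x + 1[%classic x by rewrite /= in_itv/= ltrBlDr ltrDl ltr01.
have H1 (z : R) : `]x - 1, x + 1[%classic z -> mu.-integrable setT (EFin \o f z).
  have [C' [_ hC']] := vanishes_modulus sv vv.
  move=> _; apply: (integrable_singular0 (C := C')).
    apply: measurable_funB => //; apply: (measurableT_comp (measurable_smooth sv)).
    exact: measurable_funB.
  by move=> h; have := hC' z (z - h); rewrite subKr.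
have H2 (z s : R) : `]x - 1, x + 1[%classic z -> [set: measurableTypeR R] s ->
    derivable (f^~ s) z 1.
  by move=> _ _; have [] := df z s.
have H3 : mu.-integrable setT (EFin \o (fun h => C * majorant h)).
  by have := integrable_majorant_at C 0; under eq_fun do rewrite sub0r majorantN.
have H4 (z s : R) : `]x - 1, x + 1[%classic z -> [set: measurableTypeR R] s ->
    `|partial1of2 f z s| <= C * majorant s.
  move=> _ _; rewrite d1; apply: singular_le_majorant.
  by have := hC z (z - s); rewrite subKr.
have H5 (s : R) : 0 <= C * majorant s by rewrite mulr_ge0// majorant_ge0.
have D := @derivable_under_integral _ _ _ mu f _ measurableT x _ _ xI H1 H2 _ H5 H3 H4.
have E := @differentiation_under_integral _ _ _ mu f _ measurableT x _ _ xI H1 H2 _ H5 H3 H4.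
have Dx : is_derive x 1 (fun z => \int[mu]_h f z h) (\int[mu]_h f' x h).
  apply: DeriveDef => //; rewrite -derive1E E.
  by apply: eq_Rintegral => h _; rewrite -d1.
by apply: trigger_derive; rewrite /GRing.scale/=; ring.
Qed.

End QuarterLaplacian.

(** * Derivatives at time zero along a sequence *)

Section DifferenceQuotients.
Context {R : realType}.
Variable tn : nat -> R.
Hypotheses (tn_gt0 : forall n, 0 < tn n) (tn0 : tn n @[n --> \oo] --> 0).

Lemma derive_along (f : R -> R) l : is_derive (0 : R) 1 f l ->
  (f (tn n) - f 0) / tn n @[n --> \oo] --> l.
Proof.
case=> df <-.
have : (h^-1 *: (f (h *: 1 + 0) - f 0)) @[h --> 0^'] --> 'D_1 f 0 by exact: df.
move=> /cvgr_dnbhsP /(_ tn) H.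
have : tn n @[n --> \oo] --> 0 by [].
move=> /(conj (fun n => lt0r_neq0 (tn_gt0 n))) /H.
apply: cvg_trans; apply: near_eq_cvg; apply: nearW => n.
by rewrite /GRing.scale/= mulr1 addr0 mulrC.
Qed.

(** A one-sided derivative obtained as the limit of the derivative, by the mean
    value theorem on [0, tn n]. *)
Lemma right_derive_along (f df : R -> R) (T : R) : (forall n, tn n <= T) ->
  {within `[0, T], continuous f} -> {within `[0, T], continuous df} ->
  (forall s : R, 0 < s < T -> is_derive s 1 f (df s)) ->
  (f (tn n) - f 0) / tn n @[n --> \oo] --> df 0.
Proof.
move=> tnT cf cdf fdf.
have T0 : 0 < T := lt_le_trans (tn_gt0 0%N) (tnT 0%N).
have ex n : exists c : R, 0 < c < tn n /\ f (tn n) - f 0 = df c * tn n.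
  have [||c] := @MVT _ f df 0 (tn n) (tn_gt0 n).
  - move=> s; rewrite in_itv/= => /andP[s0 st]; apply: fdf.
    by rewrite s0 (lt_le_trans st).
  - exact: within_sub (tnT n) cf.
  by rewrite in_itv/= subr0 => ct E; exists c.
have [c hc] := choice ex.
have cE n : (f (tn n) - f 0) / tn n = df (c n).
  by have [_ ->] := hc n; rewrite mulfK// gt_eqF.
under eq_cvg do rewrite cE.
have /(continuous_within_itvP _ T0)[_ + _] := cdf.
move=> /cvg_at_rightP; apply; split=> [n|].
  by have [/andP[]] := hc n.
apply: (@squeeze_cvgr _ _ _ _ (cst 0) tn) => //; last exact: cvg_cst.
by apply: nearW => n; have [/andP[c0 ct] _] := hc n; rewrite !ltW.
Qed.

(** A differentiable function can be differentiated along any sequence of points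
    with a limiting velocity, without a curve passing through them. *)
Lemma diff_along (V : normedModType R) (f : V -> R) (z w : V) (z_ : nat -> V) :
  differentiable f z -> (tn n)^-1 *: (z_ n - z) @[n --> \oo] --> w ->
  (f (z_ n) - f z) / tn n @[n --> \oo] --> 'd f z w.
Proof.
move=> df zw.
have cdf := diff_continuous df.
pose w_ n := (tn n)^-1 *: (z_ n - z).
have hE n : z_ n - z = tn n *: w_ n by rewrite scalerA divff ?scale1r// gt_eqF.
have h0 : z_ n - z @[n --> \oo] --> (0 : V).
  under eq_cvg do rewrite hE.
  by rewrite -(scale0r w); exact: cvgZ.
have dw : 'd f z (w_ n) @[n --> \oo] --> 'd f z w.
  by apply: (@cvg_comp _ _ _ w_ ('d f z) _ (nbhs w)) => //; exact: cdf.
have rem : (f (z_ n) - f z) / tn n - 'd f z (w_ n) @[n --> \oo] --> (0 : R).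
  apply/cvgr0Pnorm_le => e e0.
  have /eqaddoP := diff_locally df.
  have e1 : 0 < e / (`|w| + 1) by rewrite divr_gt0// ltr_wpDl.
  move=> /(_ _ e1) H.
  have Hn : \forall n \near \oo, `|f (z_ n) - (f z + 'd f z (z_ n - z))| <=
      e / (`|w| + 1) * `|z_ n - z|.
    have Hn0 : \forall n \near \oo, `|(f \o shift z - (cst (f z) + 'd f z)) (z_ n - z)| <=
      e / (`|w| + 1) * `|z_ n - z| := h0 _ H.
    apply: filterS Hn0 => n /=.
    by rewrite !fctE /= /cst /= subrK.
  have wb : \forall n \near \oo, `|w_ n| <= `|w| + 1.
    have /cvgr_norm_le := zw; apply; by rewrite ltrDl.
  near=> n.
  have H' : `|f (z_ n) - (f z + 'd f z (z_ n - z))| <= e / (`|w| + 1) * `|z_ n - z|.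
    by near: n.
  have -> : (f (z_ n) - f z) / tn n - 'd f z (w_ n) =
      (f (z_ n) - (f z + 'd f z (z_ n - z))) / tn n.
    have dE : 'd f z (z_ n - z) = tn n * 'd f z (w_ n) by rewrite hE linearZ.
    by rewrite dE; field; rewrite gt_eqF.
  rewrite normrM normfV (gtr0_norm (tn_gt0 n)) ler_pdivrMr//.
  rewrite (le_trans H')// hE normrZ (gtr0_norm (tn_gt0 n)).
  rewrite mulrCA mulrC ler_wpM2r ?(ltW (tn_gt0 n))//.
  rewrite mulrAC ler_pdivrMr ?ltr_wpDl// ler_wpM2l ?(ltW e0)//.
  by near: n.
have -> : (fun n => (f (z_ n) - f z) / tn n) =
    (fun n => ((f (z_ n) - f z) / tn n - 'd f z (w_ n)) + 'd f z (w_ n)).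
  by apply/funext => n; rewrite subrK.
by rewrite -[X in _ --> X]add0r; exact: cvgD.
Unshelve. all: by end_near. Qed.

Lemma rV_cvg m (w_ : nat -> 'rV[R]_m) (w : 'rV[R]_m) :
  (forall i, w_ n 0 i @[n --> \oo] --> w 0 i) -> w_ n @[n --> \oo] --> w.
Proof.
move=> H; apply/cvgrPdist_le => /= e e0; near=> n.
rewrite /Num.Def.normr/= mx_normrE (bigmax_le _ (ltW e0))//= => -[i j] _.
rewrite !mxE/= ord1; move: j; near: n; apply: filter_forall => /= j.
exact: ((cvgrPdist_le _ _).1 (H j)).
Unshelve. all: by end_near. Qed.

Lemma cvg_pair_nbhs (U V : topologicalType) (f : nat -> U) (g : nat -> V) (a : U) (b : V) :
  f n @[n --> \oo] --> a -> g n @[n --> \oo] --> b ->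
  (f n, g n) @[n --> \oo] --> (a, b).
Proof. by move=> fa gb; apply: (@cvg_pair _ _ _ _ (nbhs a) (nbhs b)). Qed.

End DifferenceQuotients.

Section FlowQuotients.
Context {R : realType}.
Variables (C14 : R) (hC14 : is_C_1_quarter C14).
Variables (X : R -> R) (delta T : R) (phi : R -> R -> R).
Hypotheses (hX : smooth X) (hphi : is_flow X delta phi).
Hypotheses (T0 : 0 < T) (Td : T < delta).
Local Notation mu := (@lebesgue_measure R).

(** For small t the points -(M + 1) and M + 1 have not yet entered [-M, M], and
    by monotonicity neither has any point further away. *)
Lemma flow_vanishes (M : R) : 0 <= M -> exists2 t0 : R, 0 < t0 <= T &
  forall (V : normedModType R) (g : R -> V) (t : R), vanishes_beyond M g -> 0 <= t <= t0 ->
    vanishes_beyond (M + 1) (g \o phi t).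
Proof.
move=> M0.
have c0 (x : R) : phi t x @[t --> (0 : R)] --> x.
  have D : is_derive (0 : R) 1 (phi^~ x) (X (phi 0 x)).
    by apply: (flow_derive_time hphi Td); rewrite lexx ltW.
  have D0 : {for 0, continuous (phi^~ x)} := is_derive_continuous D.
  by move: D0; rewrite /prop_for /continuous_at hphi.1.
have A1 : \forall t \near (0 : R), M < phi t (M + 1).
  by have := c0 (M + 1) => /cvgr_gt; apply; rewrite ltrDl.
have A2 : \forall t \near (0 : R), phi t (- (M + 1)) < - M.
  by have := c0 (- (M + 1)) => /cvgr_lt; apply; rewrite ltrN2 ltrDl.
have A3 : \forall t \near (0 : R), M < phi t (M + 1) /\ phi t (- (M + 1)) < - M.
  exact: filterI A1 A2.
have [e /= e0 he] := (nbhs_ballP _ _).1 A3.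
exists (Num.min (e / 2) T); first by rewrite lt_min T0 divr_gt0//= ge_min lexx orbT.
move=> V g t vg /andP[t0]; rewrite le_min => /andP[te tT] x Mx.
have [b1 b2] : M < phi t (M + 1) /\ phi t (- (M + 1)) < - M.
  apply: he; rewrite /ball/= sub0r normrN ger0_norm// (le_lt_trans te)// ltr_pdivrMr//.
  by rewrite ltr_pMr// ltr1n.
apply: vg; have tTT : 0 <= t <= T by rewrite t0.
move: Mx; rewrite ltr_normr => /orP[Mx|Mx]; rewrite ltr_normr; apply/orP.
  by left; rewrite (lt_trans b1)//; apply: (flow_lt hX hphi Td).
right; rewrite ltrNr (lt_trans _ b2)//; apply: (flow_lt hX hphi Td) => //.
by rewrite ltrNr.
Qed.

Variable tn : nat -> R.
Hypotheses (tn_gt0 : forall n, 0 < tn n) (tnT : forall n, tn n <= T)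
  (tn0 : tn n @[n --> \oo] --> 0).

Lemma flow_jacobian_along (x : R) :
  (flow_jacobian X phi (tn n) x - 1) / tn n @[n --> \oo] --> derive1 X x.
Proof.
pose J (s : R) := flow_jacobian X phi s x.
have cJ : {within `[0, T], continuous J} by exact: (flow_jacobian_tame hX hphi T0 Td).1.
have cX : {within `[0, T], continuous (fun s => derive1 X (phi s x))}.
  exact: (tame_comp (smooth_derive1 hX) (flow_tame hX hphi Td)).1.
have := @right_derive_along _ tn tn_gt0 tn0 J (fun s => J s * derive1 X (phi s x)) T tnT cJ _ _.
rewrite /J flow_jacobian0 mul1r hphi.1; apply.
  by move=> s; apply: cvgM; [exact: cJ|exact: cX].
move=> s sT; have A := logjac_derive hX hphi T0 Td x sT.
have B := is_derive_expR (\int[mu]_(s in `[0, s]) derive1 X (phi s x)).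
by apply: trigger_derive; rewrite /GRing.scale/= /flow_jacobian; ring.
Qed.

(** The integrand of the difference quotient is, by the mean value theorem, the
    increment between x and y of G o phi_c with G = g' X and c in [0, tn n].
    For y close to x this is bounded through the Lipschitz constants of G and
    of the flow near x, for y far from x through the supremum of G; both bounds
    are uniform in n. *)
Lemma qlap_flow_along (M N : R) (g : R -> R) (x : R) : smooth g -> vanishes_beyond M g ->
  (forall n, vanishes_beyond N (g \o phi (tn n))) ->
  (qlap (g \o phi (tn n)) x - qlap g x) / tn n @[n --> \oo] -->
    qlap (derive1 g \* X) x.
Proof.
move=> sg vg vgn.
have sG : smooth (derive1 g \* X) by exact: (smoothM (smooth_derive1 sg) hX).
have vG : vanishes_beyond M (derive1 g \* X).
  by move=> y My; rewrite /= (vanishes_derive1 vg)// mul0r.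
set G := derive1 g \* X in sG vG *.
have sgn n : smooth (g \o phi (tn n)).
  by apply: (flow_comp_smooth hX hphi T0 Td sg); rewrite (ltW (tn_gt0 n)) tnT.
have dgt (y s : R) : 0 <= s <= T -> is_derive s 1 (fun s => g (phi s y)) (G (phi s y)).
  move=> sT; have A := flow_derive_time hphi Td y sT.
  have B := smooth_is_derive (phi s y) sg.
  by apply: trigger_derive; rewrite /GRing.scale/= /G/=; ring.
have [C [C0 hC]] := vanishes_modulus sG vG.
(* The flow is only locally Lipschitz; the constant near x is enough, since for
   |x - y| > 1 the supremum of G takes over. *)
have [K [K0 hK]] := flow_lipschitz hX hphi Td (`|x| + 1).
pose q n y := ((g (phi (tn n) x) - g x) / tn n - (g (phi (tn n) y) - g y) / tn n).
have qE n : (qlap (g \o phi (tn n)) x - qlap g x) / tn n =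
    C14 * \int[mu]_y (q n y / `|x - y| `^ (3 / 2)).
  rewrite (qlapE hC14 x (sgn n) (vgn n)) (qlapE hC14 x sg vg) -mulrBr -mulrA.
  have i1 := integrable_qlap x (sgn n) (vgn n).
  have i2 := integrable_qlap x sg vg.
  rewrite -RintegralB// -RintegralZr//; last first.
    exact: (integrableB measurableT i1 i2).
  congr (_ * _); apply: eq_Rintegral => y _; rewrite /q/=; ring.
have qle n y : `|q n y| <= C * (K + 1) * Num.min 1 `|x - y|.
  have cf : {within `[0, tn n], continuous (fun s => g (phi s x) - g (phi s y))}.
    apply: derivable_within_continuous => s; rewrite in_itv/= => /andP[s0 st].
    have sT : 0 <= s <= T by rewrite s0 (le_trans st).
    by have A := dgt x s sT; have B := dgt y s sT.
  have [|c] := @MVT _ (fun s => g (phi s x) - g (phi s y))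
     (fun s => G (phi s x) - G (phi s y)) 0 (tn n) (tn_gt0 n) _ cf.
    move=> s; rewrite in_itv/= => /andP[s0 st].
    have sT : 0 <= s <= T by rewrite ltW// (le_trans (ltW st)).
    by have A := dgt x s sT; have B := dgt y s sT; exact: is_deriveB.
  rewrite in_itv/= !hphi.1 subr0 => /andP[c0 ct] E.
  have cT : 0 <= c <= T by rewrite ltW// (le_trans (ltW ct)).
  have -> : q n y = G (phi c x) - G (phi c y).
    apply: (@mulIf _ (tn n)); first by rewrite gt_eqF.
    rewrite -E /q; field; by rewrite gt_eqF.
  rewrite (le_trans (hC _ _))// -mulrA ler_wpM2l//.
  have [xy|xy] := leP 1 `|x - y|.
    by rewrite mulr1 ge_min lerDr K0.
  rewrite ge_min; apply/orP; right.
  have yr : `|y| <= `|x| + 1.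
    rewrite -[y](subrK x) (le_trans (ler_normD _ _))// addrC lerD2l distrC ltW//.
  rewrite (le_trans (hK _ _ _ cT yr _))// ?lerDl// ler_wpM2r// lerDl//.
have qlim y : q n y @[n --> \oo] --> G x - G y.
  have lim0 (z : R) : (g (phi (tn n) z) - g z) / tn n @[n --> \oo] --> G z.
    have := derive_along tn_gt0 tn0 (@dgt z 0 _).
    by rewrite hphi.1; apply; rewrite lexx ltW.
  by apply: cvgB; exact: lim0.
under eq_cvg do rewrite qE.
rewrite (qlapE hC14 x sG vG); apply: cvgM; first exact: cvg_cst.
have mq n : measurable_fun setT (fun y => (q n y / `|x - y| `^ (3 / 2))%:E).
  apply/measurable_EFinP; apply: measurable_quotient_powR.
  apply: measurable_funB => //; apply: measurable_funM => //; apply: measurable_funB.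
    exact: measurable_smooth (sgn n).
  exact: measurable_smooth.
have [] := @dominated_convergence _ _ _ mu setT measurableT
  (fun n y => (q n y / `|x - y| `^ (3 / 2))%:E) (fun y => ((G x - G y) / `|x - y| `^ (3 / 2))%:E)
  (fun y => (C * (K + 1) * majorant (x - y))%:E) mq.
- apply/measurable_EFinP; apply: measurable_quotient_powR.
  by apply: measurable_funB => //; exact: measurable_smooth.
- apply: aeW => y _; apply: cvg_EFin; first exact: nearW.
  by apply: cvgM; [exact: qlim|exact: cvg_cst].
- exact: integrable_majorant_at.
- by apply: aeW => y n _; rewrite lee_fin; exact: singular_le_majorant.
move=> iG _ lim; rewrite /Rintegral; apply: fine_cvg; rewrite fineK//.
exact: integrable_fin_num.
Qed.

End FlowQuotients.

(** * The pointwise identity *)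

Lemma ae_forall_nat (d : measure_display) (Y : measurableType d) (R : realType)
    (mu : {measure set Y -> \bar R}) (P : nat -> Y -> Prop) :
  (forall n, {ae mu, forall x, P n x}) -> {ae mu, forall x, forall n, P n x}.
Proof.
move=> H; rewrite /almost_everywhere /prop_near1 /nbhs/=.
rewrite (_ : ~` _ = \bigcup_n ~` [set x | P n x]); first exact: negligible_bigcup.
by rewrite -setC_bigcap; congr (~` _); apply/seteqP; split=> x /= Hx n *; exact: Hx.
Qed.

Section Gradient.
Context {R : realType} {m : nat}.
Variable L : 'rV[R]_m -> 'rV[R]_m -> R.
Let Lz := fun z : 'rV[R]_m * 'rV[R]_m => L z.1 z.2.

Lemma grad_p_coord (x p : 'rV[R]_m) i :
  (grad_p L x p) 0 i = 'D_((0, delta_mx 0 i) : 'rV[R]_m * 'rV[R]_m) Lz (x, p).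
Proof.
rewrite mxE; pose e : 'rV[R]_m := delta_mx 0 i.
have E : (fun h : R => h^-1 *: (L x (h *: e + p) - L x p)) =
    (fun h : R => h^-1 *: (Lz (h *: (0, e) + (x, p)) - Lz (x, p))).
  by apply/funext => h; rewrite /Lz/= scaler0 add0r.
transitivity (lim ((fun h : R => h^-1 *: (L x (h *: e + p) - L x p)) @ 0^')) => //.
by rewrite E.
Qed.

(** The gradient in p represents the differential on purely vertical
    directions. *)
Lemma grad_p_pairing (x p q : 'rV[R]_m) : differentiable Lz (x, p) ->
  'd Lz (x, p) (0, q) = dotprod (grad_p L x p) q.
Proof.
move=> dL; rewrite {1}[q]row_sum_delta /dotprod.
have -> : (0, \sum_(j < m) q 0 j *: delta_mx 0 j) =
    \sum_(j < m) q 0 j *: ((0, delta_mx 0 j) : 'rV[R]_m * 'rV[R]_m).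
  apply: (big_ind2 (fun (b : 'rV[R]_m) (c : 'rV[R]_m * 'rV[R]_m) => (0, b) = c)).
  - by [].
  - by move=> b c b' c' <- <-; rewrite [RHS](_ : _ = (0 + 0, b + b'))// addr0.
  - by move=> j _; rewrite [RHS](_ : _ = (q 0 j *: 0, q 0 j *: delta_mx 0 j))// scaler0.
rewrite linear_sum; apply: eq_bigr => j _.
by rewrite linearZ /= grad_p_coord deriveE// mulrC.
Qed.

End Gradient.

Section PointwiseIdentity.
Context {R : realType} {m : nat}.
Variables (C14 : R) (hC14 : is_C_1_quarter C14).
Variable L : 'rV[R]_m -> 'rV[R]_m -> R.
Hypothesis dL : forall z : 'rV[R]_m * 'rV[R]_m,
  differentiable (fun z : 'rV[R]_m * 'rV[R]_m => L z.1 z.2) z.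
Variables (X : R -> R) (hX : smooth X).
Variables (u : R -> 'rV[R]_m) (M : R).
Hypotheses (M0 : 0 <= M) (su : smooth u) (vu : vanishes_beyond M u).
Local Notation mu := (@lebesgue_measure R).
Local Notation ui i := (fun y => u y 0 i).
Local Notation dui i := (derive1 (fun y => u y 0 i)).

Let sui i : smooth (ui i) := (smooth_coord i su).1.
Let vui i : vanishes_beyond M (ui i) := vanishes_coord i vu.

(** The commutator of the quarter Laplacian with multiplication by X, evaluated
    at u', coordinate by coordinate. *)
Definition qlap_commutator (x : R) : 'rV[R]_m :=
  \row_i (qlap (dui i \* X) x - X x * qlap (dui i) x).

Section AtAPoint.
Variables (delta T : R) (phi : R -> R -> R).
Hypotheses (hphi : is_flow X delta phi) (T0 : 0 < T) (Td : T < delta).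
Variables (N : R) (tn : nat -> R).
Hypotheses (tn_gt0 : forall n, 0 < tn n) (tnT : forall n, tn n <= T)
  (tn0 : tn n @[n --> \oo] --> 0).
Hypothesis vn : forall n, vanishes_beyond N (u \o phi (tn n)).
Variable x : R.
Hypothesis inv : forall n,
  L ((u \o phi (tn n)) x) (qlapv (u \o phi (tn n)) x) =
  L (u (phi (tn n) x)) (qlapv u (phi (tn n) x)) * derive1 (phi (tn n)) x.

(** The invariance divided by tn n, in the limit. On the left the velocity of the
    point (u o phi_t, qlap (u o phi_t))(x) is (X u', qlap (u' X)), because the
    quarter Laplacian sees the whole function move; on the right the point
    (u, qlap u) is moved as a whole, with velocity (X u', X qlap u'), and the
    Jacobian contributes Lu X'. *)
Lemma noether_at_point :
  dotprod (grad_p L (u x) (qlapv u x)) (qlap_commutator x) =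
  L (u x) (qlapv u x) * derive1 X x.
Proof.
pose Lz := fun z : 'rV[R]_m * 'rV[R]_m => L z.1 z.2.
pose z := (u x, qlapv u x).
pose up := \row_i (dui i x * X x) : 'rV[R]_m.
pose a n := (u (phi (tn n) x), qlapv (u \o phi (tn n)) x).
pose b n := (u (phi (tn n) x), qlapv u (phi (tn n) x)).
have Tle (n : nat) : 0 <= tn n <= T by rewrite ltW// tnT.
have d0 : is_derive (0 : R) 1 (phi^~ x) (X x).
  have := flow_derive_time hphi Td x (s := 0); rewrite hphi.1; apply.
  by rewrite lexx ltW.
have comp_lim (f : R -> R) (l : R) : is_derive x 1 f l ->
    (f (phi (tn n) x) - f x) / tn n @[n --> \oo] --> l * X x.
  move=> df; rewrite -{2}(hphi.1 x); apply: (derive_along tn_gt0 tn0 (f := fun s => f (phi s x))).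
  rewrite -{1}(hphi.1 x) in df.
  by apply: trigger_derive; rewrite /GRing.scale/= mulrC.
have ulim : (tn n)^-1 *: (u (phi (tn n) x) - u x) @[n --> \oo] --> up.
  apply: rV_cvg => i; rewrite mxE.
  rewrite (_ : (fun n => _) = fun n => (ui i (phi (tn n) x) - ui i x) / tn n).
    exact: (comp_lim (ui i) _ (smooth_is_derive x (@sui i))).
  by apply/funext => n; rewrite !mxE mulrC.
have alim : (tn n)^-1 *: (a n - z) @[n --> \oo] -->
    (up, \row_i qlap (dui i \* X) x).
  rewrite (_ : (fun n => _) = fun n => ((tn n)^-1 *: (u (phi (tn n) x) - u x),
    (tn n)^-1 *: (qlapv (u \o phi (tn n)) x - qlapv u x)))//.
  apply: cvg_pair_nbhs => //; apply: rV_cvg => i; rewrite mxE.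
  rewrite (_ : (fun n => _) = fun n =>
    (qlap (ui i \o phi (tn n)) x - qlap (ui i) x) / tn n); last first.
    by apply/funext => n; rewrite !mxE mulrC.
  have vni n : vanishes_beyond N (ui i \o phi (tn n)) := vanishes_coord i (vn n).
  exact: (qlap_flow_along hC14 hX hphi T0 Td tn_gt0 tnT tn0 (@sui i) (@vui i) vni).
have blim : (tn n)^-1 *: (b n - z) @[n --> \oo] -->
    (up, X x *: \row_i qlap (dui i) x).
  rewrite (_ : (fun n => _) = fun n => ((tn n)^-1 *: (u (phi (tn n) x) - u x),
    (tn n)^-1 *: (qlapv u (phi (tn n) x) - qlapv u x)))//.
  apply: cvg_pair_nbhs => //; apply: rV_cvg => i; rewrite !mxE mulrC.
  rewrite (_ : (fun n => _) = fun n =>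
    (qlap (ui i) (phi (tn n) x) - qlap (ui i) x) / tn n); last first.
    by apply/funext => n; rewrite !mxE mulrC.
  exact: (comp_lim (qlap (ui i)) _ (qlap_derive hC14 x (@sui i) (@vui i))).
have La := diff_along tn_gt0 tn0 (dL z) alim.
have Lb := diff_along tn_gt0 tn0 (dL z) blim.
pose J n := flow_jacobian X phi (tn n) x.
have JE n : derive1 (phi (tn n)) x = J n by exact: (flow_derive1 hX hphi T0 Td).
have Jlim : (J n - 1) / tn n @[n --> \oo] --> derive1 X x.
  exact: (flow_jacobian_along hX hphi T0 Td tn_gt0 tnT tn0 (x := x)).
have J1 : J n @[n --> \oo] --> (1 : R).
  rewrite (_ : J = fun n => ((J n - 1) / tn n) * tn n + 1); last first.
    by apply/funext => n; rewrite divfK ?gt_eqF// subrK.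
  rewrite -[X in _ --> X](add0r 1); apply: cvgD; last exact: cvg_cst.
  by rewrite -(mulr0 (derive1 X x)); exact: cvgM.
have R1 : (Lz (b n) - Lz z) / tn n * J n + Lz z * ((J n - 1) / tn n) @[n --> \oo] -->
    'd Lz z (up, X x *: \row_i qlap (dui i) x) * 1 + Lz z * derive1 X x.
  by apply: cvgD; apply: cvgM => //; exact: cvg_cst.
have E : (fun n => (Lz (a n) - Lz z) / tn n) =
    (fun n => (Lz (b n) - Lz z) / tn n * J n + Lz z * ((J n - 1) / tn n)).
  apply/funext => n; have := inv n; rewrite JE => /= I.
  rewrite /Lz /= I; field; by rewrite gt_eqF.
have La' : (fun n => (Lz (a n) - Lz z) / tn n) @ \oo -->
  'd Lz z (up, \row_i qlap (dui i \* X) x) := La.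
rewrite E in La'; have := cvg_unique (@norm_hausdorff _ _) La' R1; rewrite mulr1 => eqn.
rewrite -(@grad_p_pairing _ _ L)//.
have -> : (0, qlap_commutator x) = (up, \row_i qlap (dui i \* X) x) -
    (up, X x *: \row_i qlap (dui i) x).
  by congr (_, _); [rewrite subrr|apply/rowP => i; rewrite !mxE].
by rewrite linearB /= -/Lz -/z eqn addrAC subrr add0r.
Qed.

End AtAPoint.

Variables (delta : R) (hdelta : 0 < delta) (phi : R -> R -> R).
Hypothesis hphi : is_flow X delta phi.
Hypothesis hinv : \forall t \near (0 : R),
     {ae lebesgue_measure, forall x : R,
        L ((u \o phi t) x) (qlapv (u \o phi t) x) =
        L (u (phi t x)) (qlapv u (phi t x)) * derive1 (phi t) x}.

Lemma noether_ae : {ae mu, forall x : R,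
  dotprod (grad_p L (u x) (qlapv u x)) (qlap_commutator x) =
  L (u x) (qlapv u x) * derive1 X x}.
Proof.
have T0 : 0 < delta / 2 by rewrite divr_gt0.
have Td : delta / 2 < delta by rewrite ltr_pdivrMr// ltr_pMr// ltr1n.
have [t0 /andP[t0_gt0 t0T] ht0] := flow_vanishes hX hphi T0 Td M0.
have [e /= e0 he] := (nbhs_ballP _ _).1 hinv.
(* Up to time t1 the support of u o phi_t is controlled and the invariance
   holds. *)
pose t1 := Num.min t0 (e / 2).
have t1_gt0 : 0 < t1 by rewrite lt_min t0_gt0 divr_gt0.
pose tn (n : nat) := t1 * n.+1%:R^-1.
have tn_gt0 n : 0 < tn n by rewrite mulr_gt0// invr_gt0.
have tnt1 n : tn n <= t1 by rewrite ger_pMr// invf_le1// ler1n.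
have tn0 : tn n @[n --> \oo] --> 0.
  by rewrite -(mulr0 t1); apply: cvgM; [exact: cvg_cst|exact: cvg_harmonic].
have aen (n : nat) (H : ball 0 e (tn n)) := he (tn n) H.
have {}aen n : {ae mu, forall x : R,
     L ((u \o phi (tn n)) x) (qlapv (u \o phi (tn n)) x) =
     L (u (phi (tn n) x)) (qlapv u (phi (tn n) x)) * derive1 (phi (tn n)) x}.
  apply: aen; rewrite /ball/= sub0r normrN gtr0_norm//.
  rewrite (le_lt_trans (tnt1 n))// gt_min; apply/orP; right.
  by rewrite ltr_pdivrMr// ltr_pMr// ltr1n.
apply: filterS (ae_forall_nat aen) => x inv.
apply: (noether_at_point hphi T0 Td (N := M + 1) tn_gt0 _ tn0 _ inv) => n.
  by rewrite (le_trans (tnt1 n))// (le_trans _ t0T)// ge_min lexx.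
by apply: ht0 => //; rewrite (ltW (tn_gt0 n)) (le_trans (tnt1 n))// ge_min lexx.
Qed.

(** The terms u'(x) X(x) cancel in the two singular integrals, leaving
    u'(y) (X(x) - X(y)). *)
Lemma qlap_commutator_integral i x :
  qlap_commutator x 0 i =
  C14 * \int[mu]_y (dui i y * (X x - X y) / `|x - y| `^ (3 / 2)) /\
  mu.-integrable setT (fun y => (dui i y * (X x - X y) / `|x - y| `^ (3 / 2))%:E).
Proof.
have sd := smooth_derive1 (@sui i); have vd := vanishes_derive1 (@vui i).
have sdX := smoothM sd hX.
have vdX : vanishes_beyond M (dui i \* X) by move=> y /vd /= ->; rewrite mul0r.
have i1 := integrable_qlap x sdX vdX; have i2 := integrable_qlap x sd vd.
have i3 : mu.-integrable setT
    (fun y => (X x * ((dui i x - dui i y) / `|x - y| `^ (3 / 2)))%:E).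
  under eq_fun do rewrite EFinM; exact: integrableZl.
have E : (fun y => dui i y * (X x - X y) / `|x - y| `^ (3 / 2)) =
  (fun y => ((dui i \* X) x - (dui i \* X) y) / `|x - y| `^ (3 / 2) -
    X x * ((dui i x - dui i y) / `|x - y| `^ (3 / 2))).
  by apply/funext => y /=; ring.
split; last first.
  apply: eq_integrable (integrableB measurableT i1 i3) => // y _ /=.
  by rewrite -EFinB; congr EFin; rewrite /=; ring.
rewrite E mxE (qlapE hC14 x sdX vdX) (qlapE hC14 x sd vd).
by rewrite RintegralB// RintegralZl//; ring.
Qed.

End PointwiseIdentity.

(** * Absolute convergence of the double integrals *)

Section ProductIntegrability.
Context {R : realType}.
Local Notation mu := (@lebesgue_measure R).
Local Notation mu2 := (lebesgue_measure \x lebesgue_measure)%E.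

Let strip (M y : R) : R := \1_(`[- M, M]%classic : set R) y.

Lemma measurable_prod_singular (d : R * R -> R) : measurable_fun setT d ->
  measurable_fun setT (fun z => d z / `|z.1 - z.2| `^ (3 / 2)).
Proof.
move=> md; under eq_fun do rewrite -powRN.
apply: measurable_funM => //; apply: (measurableT_comp (measurable_powR _)).
apply: measurableT_comp => //; exact: measurable_funB.
Qed.

(** Tonelli: the inner integral in x does not depend on y. *)
Lemma integrable_strip_majorant (M : R) :
  mu2.-integrable setT (fun z : R * R => (strip M z.2 * majorant (z.1 - z.2))%:E).
Proof.
have mk : measurable_fun setT (fun z : R * R => majorant (z.1 - z.2)).
  by apply: (measurableT_comp (@measurable_majorant R)); exact: measurable_funB.
have ms : measurable_fun setT (strip M) by exact: measurable_indic.
have mf : measurable_fun setT (fun z : R * R => (strip M z.2 * majorant (z.1 - z.2))%:E).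
  apply/measurable_EFinP; apply: measurable_funM => //.
  exact: (measurableT_comp ms).
apply/(@integrable21ltyP _ _ _ _ R mu mu _ mf) => /=.
have mkE : measurable_fun setT (EFin \o @majorant R).
  by apply/measurable_EFinP; exact: measurable_majorant.
have k0 : (0 <= \int[mu]_x (majorant x)%:E)%E.
  by apply: integral_ge0 => x _; rewrite lee_fin majorant_ge0.
have kfin : (\int[mu]_x (majorant x)%:E)%E \is a fin_num.
  exact: (integrable_fin_num measurableT (integrable_majorant (R := R))).
have s0 y : 0 <= strip M y by rewrite /strip indicE.
have inner y : (\int[mu]_x `|(strip M y * majorant (x - y))%:E| =
    (strip M y)%:E * \int[mu]_x (majorant x)%:E)%E.
  rewrite -(@ge0_integral_reflect _ (EFin \o @majorant R) y)//; last first.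
    by move=> x; rewrite lee_fin majorant_ge0.
  rewrite -ge0_integralZl//=.
  - apply: eq_integral => x _; rewrite ger0_norm ?mulr_ge0 ?s0 ?majorant_ge0//.
    by rewrite EFinM -majorantN opprB.
  - exact: (measurableT_comp mkE (measurable_reflect y)).
  - by move=> x _; rewrite lee_fin majorant_ge0.
  - by rewrite lee_fin s0.
under eq_integral do rewrite inner.
rewrite ge0_integralZr//; last 2 first.
- by apply/measurable_EFinP.
- by move=> y _; rewrite lee_fin s0.
rewrite /strip integral_indic//= setIT -[X in (_ * X)%E](fineK kfin).
rewrite lte_mul_pinfty// ?lebesgue_measure_itv/=.
- by case: ifP.
by rewrite ltry.
Qed.

Lemma integrable_prod_singular (d : R * R -> R) (D M : R) : measurable_fun setT d ->
  (forall z, `|d z| <= D * (strip M z.2 * Num.min 1 `|z.1 - z.2|)) ->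
  mu2.-integrable setT (fun z => (d z / `|z.1 - z.2| `^ (3 / 2))%:E).
Proof.
move=> md hd.
have iD := integrableZl measurableT D (integrable_strip_majorant M).
apply: le_integrable iD => //.
  by apply/measurable_EFinP; exact: measurable_prod_singular.
move=> z _ /=; rewrite lee_fin -/(majorant _).
have := @singular_le_majorant _ (D * strip M z.2) (d z) (z.1 - z.2).
rewrite -mulrA => /(_ (hd z)) /le_trans; apply.
by rewrite -mulrA ler_norm.
Qed.

Lemma continuous_vanishes_integrable (M : R) (f : R -> R) : continuous f -> vanishes_beyond M f ->
  mu.-integrable setT (EFin \o f).
Proof.
move=> cf vf.
have iM : mu.-integrable `[- M, M] (EFin \o f).
  apply: continuous_compact_integrable; first exact: segment_compact.
  exact: continuous_subspaceT.
have mI : measurable (`[- M, M]%classic : set (measurableTypeR R)) by [].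
have := (@integrable_mkcond _ _ _ mu _ (EFin \o f) mI).1 iM.
apply: eq_integrable => // x _ /=; rewrite patchE; case: ifPn => // xM.
rewrite /= vf// ltNge; apply: contra xM => xM.
by rewrite inE/= in_itv/= -ler_norml.
Qed.

Lemma continuous_locally_integrable (f : R -> R) : continuous f ->
  locally_integrable [set: R] f.
Proof.
move=> cf; split; [exact: continuous_measurable_fun|exact: openT|].
move=> K _ cK.
have /integrableP[_] : mu.-integrable K (EFin \o f).
  by apply: continuous_compact_integrable => //; exact: continuous_subspaceT.
by [].
Qed.

End ProductIntegrability.

Section DivergenceIntegrand.
Context {R : realType} {m : nat}.
Local Notation mu := (@lebesgue_measure R).
Local Notation mu2 := (lebesgue_measure \x lebesgue_measure)%E.

(** The exponents 1/4 + 1/4 + 1 collect into 3/2; on the diagonal both sides are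
    0 by the convention for inverses. *)
Lemma div_quarter_integrandE (G : R -> R -> R) (phi : R -> R) (z : R * R) :
  div_quarter_integrand (fun x y => G x y / `|x - y| `^ (1 / 4)) phi z =
  G z.1 z.2 * (phi z.1 - phi z.2) / `|z.1 - z.2| `^ (3 / 2).
Proof.
rewrite /div_quarter_integrand; have [->|ne] := eqVneq (z.1 - z.2) 0.
  by rewrite normr0 !powR0 ?invr0 ?mulr0//; apply/eqP; lra.
have r0 : `|z.1 - z.2| != 0 by rewrite normr_eq0.
have -> : `|z.1 - z.2| `^ (3 / 2) =
    `|z.1 - z.2| `^ (1 / 4) * `|z.1 - z.2| `^ (1 / 4) * `|z.1 - z.2|.
  have e1 : `|z.1 - z.2| `^ 1 = `|z.1 - z.2| := powRr1 (normr_ge0 _).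
  rewrite -[X in _ = _ * X]e1 -!powRD ?r0 ?implybT//.
  by congr powR; lra.
by rewrite !invfM; ring.
Qed.

Lemma dotprodZr (a b : 'rV[R]_m) (c : R) : dotprod a (c *: b) = c * dotprod a b.
Proof. by rewrite /dotprod mulr_sumr; apply: eq_bigr => i _; rewrite !mxE mulrCA. Qed.

Variables (p g : R -> 'rV[R]_m) (P M : R).
Hypotheses (cp : forall i, continuous (fun x => p x 0 i))
  (bp : forall x i, `|p x 0 i| <= P).
Hypotheses (cg : forall i, continuous (fun x => g x 0 i))
  (vg : vanishes_beyond M g).

Lemma measurable_dotprod_tensor :
  measurable_fun setT (fun z : R * R => dotprod (p z.1) (g z.2)).
Proof.
apply: measurable_sum => i; apply: measurable_funM.
  exact: (measurableT_comp (continuous_measurable_fun (@cp i))).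
exact: (measurableT_comp (continuous_measurable_fun (@cg i))).
Qed.

Lemma dotprod_tensor_bounded : exists A : R, 0 <= A /\ forall z : R * R,
  `|dotprod (p z.1) (g z.2)| <= A * \1_(`[- M, M]%classic : set R) z.2.
Proof.
have [G hG] := choice (fun i => @continuous_bounded_itv _ _ (- M) M
  (continuous_subspaceT (@cg i))).
have P0 (i : 'I_m) : 0 <= P := le_trans (normr_ge0 _) (bp 0 i).
exists (\sum_(i < m) P * G i); split.
  by apply: sumr_ge0 => i _; rewrite mulr_ge0 ?(P0 i)//; exact: (hG i).1.
move=> z; rewrite indicE; have [zM|zM] := leP `|z.2| M.
  have zI : z.2 \in `[- M, M]%R by rewrite in_itv/= -ler_norml.
  rewrite mem_set// mulr1 (le_trans (ler_norm_sum _ _ _))//.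
  by apply: ler_sum => i _; rewrite normrM ler_pM//; exact: (hG i).2.
rewrite vg// /dotprod big1 ?normr0; last by move=> i _; rewrite mxE mulr0.
by rewrite mulr_ge0// sumr_ge0// => i _; rewrite mulr_ge0 ?(P0 i)//; exact: (hG i).1.
Qed.

Lemma integrable_div_quarter (N : R) (phi : R -> R) : smooth phi -> vanishes_beyond N phi ->
  mu2.-integrable setT (fun z : R * R =>
    (dotprod (p z.1) (g z.2) * (phi z.1 - phi z.2) / `|z.1 - z.2| `^ (3 / 2))%:E).
Proof.
move=> sphi vphi; have [A [A0 hA]] := dotprod_tensor_bounded.
have [C [C0 hC]] := vanishes_modulus sphi vphi.
have mphi := measurable_smooth sphi.
apply: (@integrable_prod_singular _ _ (A * C) M).
  apply: measurable_funM; first exact: measurable_dotprod_tensor.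
  by apply: measurable_funB; exact: (measurableT_comp mphi).
move=> z; rewrite normrM mulrACA.
by apply: ler_pM => //.
Qed.

End DivergenceIntegrand.

(** * From the pointwise identity to distributions *)

Section Regularity.
Context {R : realType} {m : nat}.

Lemma rV_derivable_continuous (f : R -> 'rV[R]_m) :
  (forall x i, derivable (fun y => f y 0 i) x 1) -> continuous f.
Proof.
move=> df x; apply: differentiable_continuous; apply/derivable1_diffP.
by apply/derivable_mxP => i j; rewrite ord1.
Qed.

Variables (C14 : R) (hC14 : is_C_1_quarter C14).
Variable L : 'rV[R]_m -> 'rV[R]_m -> R.
Hypothesis hL : Ck 2 (fun z : 'rV[R]_m * 'rV[R]_m => L z.1 z.2).
Variables (u : R -> 'rV[R]_m) (M : R).
Hypotheses (su : smooth u) (vu : vanishes_beyond M u).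

Lemma qlapv_continuous : continuous (qlapv u).
Proof.
apply: rV_derivable_continuous => x i.
rewrite (_ : (fun y => _) = qlap (fun y => u y 0 i)); last first.
  by apply/funext => y; rewrite mxE.
by have [] := qlap_derive hC14 x (smooth_coord i su).1 (vanishes_coord i vu).
Qed.

Lemma jet_continuous : continuous (fun x => (u x, qlapv u x)).
Proof.
move=> x; apply: (@cvg_pair _ _ _ _ (nbhs (u x)) (nbhs (qlapv u x))).
  by apply: rV_derivable_continuous => y i; exact: ((smooth_coord i su).1 0%N y).
exact: qlapv_continuous.
Qed.

Lemma energy_continuous : continuous (fun x => L (u x) (qlapv u x)).
Proof.
move=> x; have := @jet_continuous x => jx.
apply: (@continuous_comp _ _ _ (fun x => (u x, qlapv u x))
  (fun z : 'rV[R]_m * 'rV[R]_m => L z.1 z.2) x jx).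
by apply: differentiable_continuous; exact: hL.1.
Qed.

Let grad_coord i := 'D_((0, delta_mx 0 i) : 'rV[R]_m * 'rV[R]_m)
  (fun z : 'rV[R]_m * 'rV[R]_m => L z.1 z.2).

Let grad_coord_continuous i : continuous (grad_coord i).
Proof.
move=> z; apply: differentiable_continuous; exact: (hL.2 _).1.
Qed.

Lemma grad_p_continuous i : continuous (fun x => (grad_p L (u x) (qlapv u x)) 0 i).
Proof.
move=> x; rewrite (_ : (fun y => _) = grad_coord i \o (fun x => (u x, qlapv u x))).
  by apply: continuous_comp; [exact: jet_continuous|exact: grad_coord_continuous].
by apply/funext => y; rewrite grad_p_coord.
Qed.

(** Both u and its quarter Laplacian are bounded, so (u, qlap u) stays in a
    compact box, on which the continuous function D_p L is bounded. *)
Lemma grad_p_bounded : exists P : R, forall x i, `|(grad_p L (u x) (qlapv u x)) 0 i| <= P.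
Proof.
have [A hA] := choice (fun i => vanishes_bounded (smooth_coord i su).1 (vanishes_coord i vu)).
have [B hB] := choice (fun i => qlap_bounded hC14 (smooth_coord i su).1 (vanishes_coord i vu)).
pose box (b : 'I_m -> R) := [set v : 'rV[R]_m | forall i, `[- b i, b i]%classic (v ord0 i)].
have cbox b : compact (box b).
  apply: (@rV_compact R m (fun i => `[- b i, b i]%classic)) => i.
  exact: segment_compact.
have inbox x : (box A `*` box B) (u x, qlapv u x).
  split=> i /=; rewrite in_itv/= -ler_norml; first exact: (hA i).2.
  by rewrite mxE; exact: (hB i).2.
have bnd i : exists P : R, forall x, `|(grad_p L (u x) (qlapv u x)) 0 i| <= P.
  have : compact (grad_coord i @` (box A `*` box B)).
    apply: continuous_compact; last exact: compact_setX.
    by apply: continuous_subspaceT; exact: grad_coord_continuous.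
  move=> /compact_bounded[P [_ hP]]; exists (P + 1) => x.
  apply: hP; first by rewrite ltrDl.
  by exists (u x, qlapv u x); rewrite ?grad_p_coord//; exact: inbox.
have [P hP] := choice bnd.
exists (\sum_i `|P i|) => x i; rewrite (le_trans (hP i x))//.
rewrite (bigD1 i)//= (le_trans (ler_norm _))// lerDl sumr_ge0//.
Qed.

End Regularity.

Lemma integral_linear_combination (R : realType) (I : Type) (s : seq I) (c : I -> R)
    (f : I -> R -> R) :
  (forall i, lebesgue_measure.-integrable setT (EFin \o f i)) ->
  lebesgue_measure.-integrable setT (EFin \o (fun y => \sum_(i <- s) c i * f i y)) /\
  \int[@lebesgue_measure R]_y (\sum_(i <- s) c i * f i y) =
    \sum_(i <- s) c i * \int[@lebesgue_measure R]_y f i y.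
Proof.
move=> fi.
have ci i : lebesgue_measure.-integrable setT (EFin \o (fun y => c i * f i y)).
  exact: (integrableZl measurableT (c i) (fi i)).
elim: s => [|i s [iS E]].
  rewrite (_ : (fun y => _) = cst 0); last by apply/funext => y; rewrite big_nil.
  rewrite big_nil; split; first exact: integrable0.
  by rewrite Rintegral_cst// mul0r.
rewrite (_ : (fun y => _) = fun y => c i * f i y + \sum_(j <- s) c j * f j y); last first.
  by apply/funext => y; rewrite big_cons.
split; first exact: (integrableD measurableT (ci i) iS).
by rewrite RintegralD// E RintegralZl// big_cons.
Qed.

Section Noether.
Context {R : realType} {m : nat}.
Local Notation mu := (@lebesgue_measure R).
Local Notation mu2 := (lebesgue_measure \x lebesgue_measure)%E.
Variables (C14 : R) (hC14 : is_C_1_quarter C14).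
Variable L : 'rV[R]_m -> 'rV[R]_m -> R.
Hypothesis hL : Ck 2 (fun z : 'rV[R]_m * 'rV[R]_m => L z.1 z.2).
Variables (X : R -> R) (hX : smooth X).
Variables (u : R -> 'rV[R]_m) (M : R).
Hypotheses (su : smooth u) (vu : vanishes_beyond M u).

Let Lu x := L (u x) (qlapv u x).
Let p x := grad_p L (u x) (qlapv u x).

Hypothesis pointwise : {ae mu, forall x,
  dotprod (p x) (qlap_commutator X u x) = Lu x * derive1 X x}.

Lemma derive1_coord_continuous i : continuous (fun y => (derive1 u y) 0 i).
Proof.
have [si sE] := smooth_coord i su.
rewrite (_ : (fun y => _) = derive1 (fun y => u y 0 i)); last by apply/funext => y.
exact: smooth_continuous (smooth_derive1 si).
Qed.

Lemma scaled_derive1_coord_continuous i : continuous (fun y => (X y *: derive1 u y) 0 i).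
Proof.
rewrite (_ : (fun y => _) = fun y => X y * (derive1 u y) 0 i); last first.
  by apply/funext => y; rewrite mxE.
move=> x; apply: cvgM; first exact: smooth_continuous.
exact: derive1_coord_continuous.
Qed.

Lemma vanishes_derive1_u : vanishes_beyond M (derive1 u).
Proof. exact: vanishes_derive1. Qed.

Lemma vanishes_scaled_derive1_u : vanishes_beyond M (fun y => X y *: derive1 u y).
Proof. by move=> y My; rewrite vanishes_derive1_u// scaler0. Qed.

Let F (x y : R) := dotprod (p x) (derive1 u y).
Let FX (x y : R) := dotprod (p x) (X y *: derive1 u y).

Lemma integrable_F (N : R) (phi : R -> R) : smooth phi -> vanishes_beyond N phi ->
  mu2.-integrable setT (EFin \o
    div_quarter_integrand (fun x y => F x y / `|x - y| `^ (1 / 4)) phi).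
Proof.
move=> sphi vphi; have [P hP] := grad_p_bounded hC14 hL su vu.
rewrite /comp; under eq_fun do rewrite div_quarter_integrandE.
apply: (integrable_div_quarter _ hP _ vanishes_derive1_u sphi vphi).
  exact: (grad_p_continuous hC14 hL su vu).
exact: derive1_coord_continuous.
Qed.

Lemma integrable_FX (N : R) (phi : R -> R) : smooth phi -> vanishes_beyond N phi ->
  mu2.-integrable setT (EFin \o
    div_quarter_integrand (fun x y => FX x y / `|x - y| `^ (1 / 4)) phi).
Proof.
move=> sphi vphi; have [P hP] := grad_p_bounded hC14 hL su vu.
rewrite /comp; under eq_fun do rewrite div_quarter_integrandE.
apply: (integrable_div_quarter _ hP _ vanishes_scaled_derive1_u sphi vphi).
  exact: (grad_p_continuous hC14 hL su vu).
exact: scaled_derive1_coord_continuous.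
Qed.

(** The two integrands differ by psi(x) p(x) . u'(y) (X(x) - X(y)) /
    |x - y|^{3/2}, where psi is the test function. The inner integral in y is the
    commutator, to which the pointwise identity applies. *)
Lemma div_quarter_difference (N : R) (phi : R -> R) : smooth phi -> vanishes_beyond N phi ->
  C14 * div_quarter (fun x y => F x y / `|x - y| `^ (1 / 4)) (X \* phi) -
  C14 * div_quarter (fun x y => FX x y / `|x - y| `^ (1 / 4)) phi =
  \int[mu]_x (Lu x * derive1 X x * phi x).
Proof.
move=> sphi vphi.
have sXphi := smoothM hX sphi.
have vXphi : vanishes_beyond N (X \* phi) by move=> y /vphi /= ->; rewrite mulr0.
have i1 := integrable_F sXphi vXphi; have i2 := integrable_FX sphi vphi.
rewrite /div_quarter -mulrBr -RintegralB//.
set D := fun z : R * R => _ - _.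
have DE x y : D (x, y) = phi x * (F x y * (X x - X y) / `|x - y| `^ (3 / 2)).
  by rewrite /D !div_quarter_integrandE/= /FX dotprodZr -/(F x y); ring.
have iD : mu2.-integrable setT (EFin \o D).
  exact: (integrableB measurableT i1 i2).
pose H x := \int[mu]_y D (x, y).
have HE x : C14 * H x = phi x * dotprod (p x) (qlap_commutator X u x) /\
    (\int[mu]_y (D (x, y))%:E = (H x)%:E)%E.
  have iy i := (qlap_commutator_integral hC14 hX su vu i x).2.
  have FE y : F x y * (X x - X y) / `|x - y| `^ (3 / 2) = \sum_(i < m)
     p x 0 i * (derive1 (fun y => u y 0 i) y * (X x - X y) / `|x - y| `^ (3 / 2)).
    rewrite /F /dotprod !mulr_suml; apply: eq_bigr => i _.
    by rewrite (smooth_coord i su).2 !mulrA.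
  have [iS ES] := integral_linear_combination (index_enum 'I_m) (fun i => p x 0 i) iy.
  have DS : (fun y => D (x, y)) = fun y => phi x * \sum_(i < m)
     p x 0 i * (derive1 (fun y => u y 0 i) y * (X x - X y) / `|x - y| `^ (3 / 2)).
    by apply/funext => y; rewrite DE FE.
  have iDx : mu.-integrable setT (EFin \o (fun y => D (x, y))).
    by rewrite DS; exact: (integrableZl measurableT (phi x) iS).
  split; last by rewrite /H /Rintegral fineK//; exact: (integrable_fin_num measurableT iDx).
  rewrite /H DS RintegralZl// ES mulrCA; congr (_ * _).
  rewrite /dotprod mulr_sumr; apply: eq_bigr => i _.
  by rewrite (qlap_commutator_integral hC14 hX su vu i x).1 mulrCA.
have FE : (\int[mu2]_z (D z)%:E = \int[mu]_x (H x)%:E)%E.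
  rewrite -(integral12_prod_meas1 iD); apply: eq_integral => x _.
  by rewrite -(HE x).2.
have iH : mu.-integrable setT (EFin \o H).
  apply: eq_integrable (integrable_fubini_F iD) => // x _.
  by rewrite /= -(HE x).2.
transitivity (C14 * \int[mu]_x H x); first by rewrite /Rintegral FE.
rewrite -RintegralZl// /Rintegral; congr fine.
have cLu : continuous Lu := energy_continuous hC14 hL su vu.
apply: ae_eq_integral => //.
- exact: (measurable_int _ (integrableZl measurableT C14 iH)).
- apply/measurable_EFinP; apply: continuous_measurable_fun => x.
  apply: cvgM; last exact: (@smooth_continuous _ phi sphi x).
  by apply: cvgM; [exact: cLu|exact: (@smooth_continuous _ _ (smooth_derive1 hX) x)].
- have [N0 [mN0 N00 sub]] := pointwise; exists N0; split => //.
  apply: subset_trans sub => x /= nHx Hx; apply: nHx => _; congr EFin.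
  by rewrite (HE x).1 Hx mulrC.
Qed.

(** The term Lu X' psi left over by [div_quarter_difference] is the one produced
    by the Leibniz rule for (X psi)'. *)
Lemma noether_distr (N : R) (phi : R -> R) : smooth phi -> vanishes_beyond N phi ->
  C14 * div_quarter (fun x y => F x y / `|x - y| `^ (1 / 4)) (X \* phi)
    - \int[mu]_x (Lu x * derive1 (X \* phi) x) =
  C14 * div_quarter (fun x y => FX x y / `|x - y| `^ (1 / 4)) phi
    - \int[mu]_x (Lu x * X x * derive1 phi x).
Proof.
move=> sphi vphi.
have cLu : continuous Lu := energy_continuous hC14 hL su vu.
have sX' := smooth_derive1 hX; have sphi' := smooth_derive1 sphi.
have vphi' := vanishes_derive1 vphi.
have iA : mu.-integrable setT (EFin \o (fun x => Lu x * derive1 X x * phi x)).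
  apply: (@continuous_vanishes_integrable _ N); last by move=> y /vphi ->; rewrite mulr0.
  move=> x; apply: cvgM; [apply: cvgM; first exact: cLu|]; exact: smooth_continuous.
have iB : mu.-integrable setT (EFin \o (fun x => Lu x * X x * derive1 phi x)).
  apply: (@continuous_vanishes_integrable _ N); last by move=> y /vphi' ->; rewrite mulr0.
  move=> x; apply: cvgM; [apply: cvgM; first exact: cLu|]; exact: smooth_continuous.
have dE x : derive1 (X \* phi) x = derive1 X x * phi x + X x * derive1 phi x.
  rewrite derive1E; have A := smooth_is_derive x hX; have B := smooth_is_derive x sphi.
  have E : is_derive x 1 (X \* phi) (derive1 X x * phi x + X x * derive1 phi x).
    by apply: trigger_derive; rewrite /GRing.scale/=; ring.
  by have [_ ->] := E.
have -> : \int[mu]_x (Lu x * derive1 (X \* phi) x) =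
    \int[mu]_x (Lu x * derive1 X x * phi x) + \int[mu]_x (Lu x * X x * derive1 phi x).
  by rewrite -RintegralD//; apply: eq_Rintegral => x _; rewrite dE; ring.
by rewrite -(div_quarter_difference sphi vphi); ring.
Qed.

End Noether.

Theorem proposition4p12 (R : realType) (C14 : R) (hC14 : is_C_1_quarter C14)
  (m : nat) (hm : (1 <= m)%N)
  (L : 'rV[R]_m -> 'rV[R]_m -> R)
  (hL : Ck 2 (fun z : 'rV[R]_m * 'rV[R]_m => L z.1 z.2))
  (hgrowth : exists C r : R, 2 <= r /\ forall x p : 'rV[R]_m,
     `|L x p| <= C * (enorm x ^+ 2 + enorm x `^ r + enorm p ^+ 2))
  (X : R -> R) (hX : smooth X)
  (delta : R) (hdelta : 0 < delta)
  (phi : R -> R -> R) (hphi : is_flow X delta phi)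
  (u : R -> 'rV[R]_m) (hu : Cc_infty u)
  (hinv : \forall t \near (0 : R),
     {ae lebesgue_measure, forall x : R,
        L ((u \o phi t) x) (qlapv (u \o phi t) x) =
        L (u (phi t x)) (qlapv u (phi t x)) * derive1 (phi t) x}) :
  let Lu := fun x : R => L (u x) (qlapv u x) in
  let F := fun x y : R =>
    dotprod (grad_p L (u x) (qlapv u x)) (derive1 u y) / `|x - y| `^ (1 / 4) in
  let FX := fun x y : R =>
    dotprod (grad_p L (u x) (qlapv u x)) (X y *: derive1 u y)
      / `|x - y| `^ (1 / 4) in
  let lhs := C14 \*o distr_mul (div_quarter F) X
             \+ distr_mul (distr_ddx (distr_of Lu)) X in
  let rhs := C14 \*o div_quarter FX \+ distr_ddx (distr_of (Lu \* X)) in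
  (* all four distributions are well defined *)
  [/\ div_quarter_defined F, div_quarter_defined FX,
      locally_integrable [set: R] Lu & locally_integrable [set: R] (Lu \* X)]
  /\ distr_eq lhs rhs
  /\ (distr_eq lhs (fun=> 0) -> distr_eq rhs (fun=> 0)).
Proof.
move=> Lu F FX lhs rhs.
have su := hu.1; have [M M0 vu] := Cc_infty_vanishes hu.
have cLu : continuous Lu := energy_continuous hC14 hL su vu.
have eqT : distr_eq lhs rhs.
  move=> psi hpsi; have [N _ vpsi] := Cc_infty_vanishes hpsi.
  have ae := noether_ae hC14 hL.1 hX M0 su vu hdelta hphi hinv.
  have := noether_distr hC14 hL hX su vu ae hpsi.1 vpsi.
  by rewrite /lhs /rhs /= /distr_mul /distr_ddx /distr_of.
split; [split|split].
- by move=> psi hpsi; have [N _ vpsi] := Cc_infty_vanishes hpsi;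
    exact: (integrable_F hC14 hL su vu hpsi.1 vpsi).
- by move=> psi hpsi; have [N _ vpsi] := Cc_infty_vanishes hpsi;
    exact: (integrable_FX hC14 hL hX su vu hpsi.1 vpsi).
- exact: continuous_locally_integrable.
- apply: continuous_locally_integrable => x.
  by apply: cvgM; [exact: cLu|exact: smooth_continuous].
- exact: eqT.
- by move=> lhs0 psi hpsi; rewrite -(eqT psi hpsi) lhs0.
Qed.
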